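(* Let $(\mathcal M,\{\cdot,\cdot\}_{\rm nh},H_{\mathcal M})$ be a nonholonomic system with a $G$-symmetry satisfying conditions $(\mathcal A1)$–$(\mathcal A4)$. Let $\{\xi_1,\dots,\xi_k\}$ be a global $G$-invariant basis of $\Gamma(\mathfrak g_S)$ and $X_0$ a $\rho_Q$-projectable vector field on $Q$ generating the $S$-orthogonal horizontal space $H=S^\perp\cap D$. Assume that the kinetic energy metric $\kappa$ is strong invariant on $S$ and that $\kappa(X_0,[Y,X_0])=0$ for all $Y\in\Gamma(S)$. Then the 2-form $B_{\rm HGS}=\langle J,\sigma_{\rm HGS}\rangle$ is written with respect to the basis $\{\xi_1,\dots,\xi_k\}$ as $$B_{\rm HGS}=\langle J,\mathcal K_{\mathcal W}\rangle-\langle J,R_{ij}\,\mathcal X^0\wedge\mathcal Y^j\otimes\xi_i\rangle+\langle J,d^{\mathcal C}\mathcal Y^i\otimes\xi_i\rangle = p_a\,d^{\mathcal C}\varepsilon^a-J_iR_{ij}\,\mathcal X^0\wedge\mathcal Y^j+J_i\,d^{\mathcal C}\mathcal Y^i,$$ where $J_i=\mathbf i_{(\xi_i)_{\mathcal M}}\Theta_{\mathcal M}$, $$R_{ij}=\kappa^{il}\big[\kappa(Y_l,[Y_j,X_0])+\kappa(X_0,[Y_j,Y_l])\big],\qquad Y_i=(\xi_i)_Q,$$ with $(\kappa^{il})$ the inverse of the matrix $(\kappa(Y_i,Y_l))$, and $\mathcal X^0=\tau_{\mathcal M}^*X^0$, $\mathcal Y^i=\tau_{\mathcal M}^*Y^i$,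 $\varepsilon^a=\tau_{\mathcal M}^*\epsilon^a$.
   Context: All objects are smooth; summation over repeated indices is understood. Nonholonomic system: a manifold $Q$, a Lagrangian $L=\kappa-U:TQ\to\mathbb R$ of mechanical type (kinetic energy of a Riemannian metric, also denoted $\kappa$, minus a potential $U$), and a nonintegrable constant-rank distribution $D\subset TQ$. Let $\mathrm{Leg}:TQ\to T^*Q$ be the Legendre transformation, $\mathcal M:=\mathrm{Leg}(D)$, $\iota:\mathcal M\to T^*Q$ the inclusion, $\tau_{\mathcal M}:\mathcal M\to Q$ the projection, $\Theta_Q$ the Liouville 1-form, $\Omega_Q=-d\Theta_Q$, $\Theta_{\mathcal M}=\iota^*\Theta_Q$, $\Omega_{\mathcal M}=\iota^*\Omega_Q$, $H_{\mathcal M}$ the restriction of the Hamiltonian induced by $L$. Let $\mathcal C_m=\{v\in T_m\mathcal M: T\tau_{\mathcal M}(v)\in D\}$; $\Omega_{\mathcal M}|_{\mathcal C}$ is nondegenerate. The nonholonomic bracket is defined by $X_f=\{\cdot,f\}_{\rm nh}$ iff $X_f$ takes values in $\mathcal C$ and $\mathbf i_{X_f}\Omega_{\mathcal M}|_{\mathcal C}=df|_{\mathcal C}$; $X_{\rm nh}=\{\cdot,H_{\mathcal M}\}_{\rm nh}$. $G$-symmetry: a free and proper action of a Lie group $G$ (Lie algebra $\mathfrak g$) on $Q$ whose tangent lift leaves $L$ and $D$ invariant; the cotangent lift restricts to $\mathcal M$. For a section $\xi$ of $Q\times\mathfrak g\to Q$, $\xi_Q(q)=(\xi(q))_Q(q)$,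 $\xi_{\mathcal M}(m)=(\xi(\tau_{\mathcal M}(m)))_{\mathcal M}(m)$ (infinitesimal generators). $V$ is the tangent distribution to the $G$-orbits, $S:=D\cap V$, $(\mathfrak g_S)_q=\{\eta\in\mathfrak g:\eta_Q(q)\in S_q\}$, $k=\mathrm{rank}(S)$, $\rho_Q:Q\to Q/G$ the orbit projection. A section $\xi$ is $G$-invariant if $[\xi,\eta]=0$ for all $\eta\in\mathfrak g$ (bracket of the action Lie algebroid; infinitesimal form of $\xi(g\cdot q)=\mathrm{Ad}_g\xi(q)$; equivalently $\xi_Q$ is $G$-invariant). Conditions: $(\mathcal A1)$ $T_qQ=D_q+V_q$ for all $q$; $(\mathcal A2)$ the bundle $\mathfrak g_S\to Q$ is trivial; $(\mathcal A3)$ the $G$-action on $Q$ is proper and free; $(\mathcal A4)$ $\dim(Q/G)=1$. $\kappa$ is strong invariant on $S$ if $\kappa(Y_1,[Y_2,Y_3])=-\kappa(Y_3,[Y_2,Y_1])$ for all $G$-invariant $Y_1,Y_2,Y_3\in\Gamma(S)$. Frames: fix a vertical complement $W\subset V$ of $D$ ($TQ=D\oplus W$), so $TQ=H\oplus S\oplus W$, with projections $P_D:TQ=D\oplus W\to D$ and $P_W:TQ\to W$. $\{X_0,Y_i,Z_a\}$ is a basis of $TQ$ with $Y_i=(\xi_i)_Q$ and $\{Z_a\}$ a (possibly local) basis of $W$; $\{X^0,Y^i,\epsilon^a\}$ is the dual basis of $T^*Q$; $(p_0,p_i,p_a)$ are the induced coordinates on $T^*Q$, restricted to $\mathcal M$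 (so $p_a(m)=\langle m,Z_a\rangle$, $p_i=J_i$). For a 1-form $\alpha$ on $Q$, $d^{\mathcal C}(\tau_{\mathcal M}^*\alpha):=\tau_{\mathcal M}^*\big(d\alpha(P_D\cdot,P_D\cdot)\big)$. $A_W:TQ\to\mathfrak g$ is defined by $A_W(X)=\eta$ iff $\eta_Q=P_W(X)$, $K_W:=dA_W(P_D\cdot,P_D\cdot)$, $\mathcal K_{\mathcal W}:=\tau_{\mathcal M}^*K_W$. $J:\mathcal M\to\mathfrak g^*$, $\langle J(m),\eta\rangle=\Theta_{\mathcal M}(\eta_{\mathcal M})(m)$, is the momentum map. The 2-form $B_{\rm HGS}$: a horizontal gauge symmetry is $\zeta\in\Gamma(\mathfrak g_S)$ such that $\mathbf i_{\zeta_{\mathcal M}}\Theta_{\mathcal M}$ is a first integral of $X_{\rm nh}$ (the latter function is then a horizontal gauge momentum). Under the hypotheses of the theorem there is a basis $\{\zeta_1,\dots,\zeta_k\}$ of $\Gamma(\mathfrak g_S)$ of $G$-invariant horizontal gauge symmetries, given by $\zeta_l=(\rho_Q^*\bar f^{\,l}_i)\xi_i$ with $\bar f^{\,l}=(\bar f^{\,l}_1,\dots,\bar f^{\,l}_k)$, $l=1,\dots,k$, independent solutions of $R_{ij}\bar f_j-\bar X_0(\bar f_i)=0$ on $Q/G$, $\bar X_0=T\rho_Q(X_0)$. Let $Y^i_{\rm HGS}$ be the 1-forms on $Q$ with $Y^i_{\rm HGS}((\zeta_j)_Q)=\delta_{ij}$ and $Y^i_{\rm HGS}|_H=Y^i_{\rm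 HGS}|_W=0$, and $\mathcal Y^i_{\rm HGS}=\tau_{\mathcal M}^*Y^i_{\rm HGS}$. Then $\sigma_{\rm HGS}:=\mathcal K_{\mathcal W}+d^{\mathcal C}\mathcal Y^i_{\rm HGS}\otimes\zeta_i$ and $B_{\rm HGS}:=\langle J,\sigma_{\rm HGS}\rangle=\langle J,\mathcal K_{\mathcal W}\rangle+\langle J,\zeta_i\rangle\,d^{\mathcal C}\mathcal Y^i_{\rm HGS}$. *)

(* Defs.v *)
From HB Require Import structures.
From mathcomp Require Import all_boot all_order all_algebra.
From mathcomp Require Import all_classical all_reals all_analysis.
Set Implicit Arguments.
Unset Strict Implicit.
Unset Printing Implicit Defensive.
Import Order.TTheory GRing.Theory Num.Theory.
Import numFieldNormedType.Exports.
Local Open Scope classical_set_scope.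
Local Open Scope ring_scope.

Section SmoothRn.
Variables (R : realType) (n : nat).
Implicit Types (U : set 'rV[R]_n) (F : 'rV[R]_n -> R^o).

Fixpoint Ck_on U (k : nat) F : Prop :=
  match k with
  | 0 => forall x, U x -> {for x, continuous F}
  | k'.+1 => (forall x, U x -> differentiable F x) /\
             (forall i : 'I_n, Ck_on U k' (fun x => 'D_(delta_mx 0 i) F x))
  end.

Definition Cinf_near F (x : 'rV[R]_n) : Prop :=
  exists U, [/\ open U, U x & forall k, Ck_on U k F].

End SmoothRn.

(* Smooth structures are given by functions (Sikorski's differential spaces):
   a smooth space is a set with a family of generating real functions.  Its
   topology is the initial one, and a function is smooth when it is locally a
   C^oo function of finitely many generators.  A manifold is a smooth space with
   this topology Hausdorff and second countable that admits charts; every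
   manifold in the atlas sense is obtained by taking all its smooth functions
   as generators. *)

Record smoothSpace (R : realType) := SmoothSpace {
  carrier :> Type;
  gens : set (carrier -> R) }.

HB.instance Definition _ (R : realType) (X : smoothSpace R) :=
  gen_eqMixin (carrier X).
HB.instance Definition _ (R : realType) (X : smoothSpace R) :=
  gen_choiceMixin (carrier X).

Definition eval_gens (R : realType) (X : smoothSpace R) (x : carrier X) :
    prod_topology (fun _ : {c : X -> R | gens c} => R : topologicalType) :=
  fun c => sval c x.

HB.instance Definition _ (R : realType) (X : smoothSpace R) :=
  Topological.copy (carrier X) (initial_topology (@eval_gens R X)).

Section Smooth.
Variable R : realType.
Implicit Types X Y : smoothSpace R.

Definition smooth_at X (f : X -> R) (p : X) : Prop :=
  exists (m : nat) (c : 'I_m -> X -> R) (F : 'rV[R]_m -> R^o),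
    [/\ forall i, gens (c i),
        Cinf_near F (\row_i c i p) &
        \forall x \near p, f x = F (\row_i c i x)].

Definition smooth X (f : X -> R) : Prop := forall p, smooth_at f p.

Definition smooth_map X Y (phi : X -> Y) : Prop :=
  forall (p : X) (f : Y -> R), smooth_at f (phi p) -> smooth_at (f \o phi) p.

Definition chart (n : nat) X (U : set X) (x : X -> 'rV[R]_n) : Prop :=
  [/\ open U,
      {in U &, injective x},
      forall V : set X, V `<=` U -> (open V <-> open (x @` V)) &
      forall (p : X) (f : X -> R), U p ->
        (smooth_at f p <->
         exists2 F : 'rV[R]_n -> R^o,
           Cinf_near F (x p) & \forall y \near p, f y = F (x y))].

Definition is_manifold (n : nat) X : Prop :=
  [/\ hausdorff_space X,
      @second_countable X &
      forall p : X, exists U x, U p /\ @chart n X U x].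

Definition prod_space X Y : smoothSpace R :=
  @SmoothSpace R (X * Y)%type
    [set c | (exists2 a, gens a & c = a \o fst) \/
             (exists2 b, gens b & c = b \o snd)].

Definition sub_space X (A : set X) : smoothSpace R :=
  @SmoothSpace R {x : X | A x} [set c | exists2 a, gens a & c = a \o sval].

Definition incl X (A : set X) (x : sub_space A) : X := sval x.

End Smooth.

(* Tangent vectors at [p] are the derivations of the germs at [p] of smooth
   functions, extended by 0 to the functions that are not smooth at [p]. *)

Definition tvec (R : realType) (X : smoothSpace R) := (X -> R) -> R^o.

Section Tangent.
Variable R : realType.
Implicit Types X Y : smoothSpace R.

Definition tangent X (p : X) (v : tvec X) : Prop :=
  [/\ forall (a : R) f g, smooth_at f p -> smooth_at g p ->
        v (fun x => a * f x + g x) = a * v f + v g,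
      forall f g, smooth_at f p -> smooth_at g p ->
        v (fun x => f x * g x) = f p * v g + g p * v f,
      forall f g, (\forall x \near p, f x = g x) -> v f = v g &
      forall f, ~ smooth_at f p -> v f = 0].

Definition push X Y (phi : X -> Y) (p : X) (v : tvec X) : tvec Y :=
  fun f => if `[< smooth_at f (phi p) >] then v (f \o phi) else 0.

Definition vfield_on X (U : set X) (A : X -> tvec X) : Prop :=
  forall p, U p -> tangent p (A p) /\
    forall f, smooth_at f p -> smooth_at (fun q => A q f) p.

Definition vfield_near X (p : X) (A : X -> tvec X) : Prop :=
  exists U, [/\ open U, U p & vfield_on U A].

Definition vfield X (A : X -> tvec X) : Prop := vfield_on setT A.

Definition lie_bracket X (A B : X -> tvec X) : X -> tvec X := fun p f =>
  if `[< smooth_at f p >] then A p (fun q => B q f) - B p (fun q => A q f)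
  else 0.

Definition form1 X := X -> tvec X -> R.
Definition form2 X := X -> tvec X -> tvec X -> R.

Definition one_form_on X (U : set X) (alpha : form1 X) : Prop :=
  forall p, U p ->
    (forall (a : R) u v, tangent p u -> tangent p v ->
       alpha p (a *: u + v) = a * alpha p u + alpha p v) /\
    (forall A, vfield_near p A -> smooth_at (fun q => alpha q (A q)) p).

Definition one_form X (alpha : form1 X) : Prop := one_form_on setT alpha.

Definition extension X (p : X) (v : tvec X) : X -> tvec X :=
  get [set A | vfield_near p A /\ A p = v].

(* dalpha(A,B) = A(alpha(B)) - B(alpha(A)) - alpha([A,B]); on a manifold the
   value at [p] depends on A and B only through A_p = u and B_p = v. *)
Definition ext_d X (alpha : form1 X) : form2 X := fun p u v =>
  let A := extension p u in
  let B := extension p v in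
  A p (fun q => alpha q (B q)) - B p (fun q => alpha q (A q))
    - alpha p (lie_bracket A B p).

Definition wedge X (alpha beta : form1 X) : form2 X := fun p u v =>
  alpha p u * beta p v - alpha p v * beta p u.

Definition pull1 X Y (phi : X -> Y) (alpha : form1 Y) : form1 X :=
  fun p u => alpha (phi p) (push phi p u).

Definition pull2 X Y (phi : X -> Y) (omega : form2 Y) : form2 X :=
  fun p u v => omega (phi p) (push phi p u) (push phi p v).

Definition basis_of X (m : nat) (S : set (tvec X)) (e : 'I_m -> tvec X) :=
  (forall v, S v <-> exists a : 'I_m -> R, v = \sum_i a i *: e i) /\
  (forall a : 'I_m -> R, \sum_i a i *: e i = 0 -> forall i, a i = 0).

Definition distribution (r : nat) X (D : X -> set (tvec X)) : Prop :=
  forall p, exists (U : set X) (A : 'I_r -> X -> tvec X),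
    [/\ open U, U p, forall i, vfield_on U (A i) &
        forall q, U q -> basis_of (D q) (fun i => A i q)].

Definition integrable_dist (r : nat) X (D : X -> set (tvec X)) : Prop :=
  forall p, exists N : set X,
    [/\ N p, is_manifold r (sub_space N) &
        forall (x : sub_space N) v,
          D (incl x) v <-> exists2 w, tangent x w & push (@incl _ _ _) x w = v].

Definition riemannian X (kappa : X -> tvec X -> tvec X -> R) : Prop :=
  forall p : X,
  [/\ forall (a : R) u v w, tangent p u -> tangent p v -> tangent p w ->
        kappa p (a *: u + v) w = a * kappa p u w + kappa p v w,
      forall u v, tangent p u -> tangent p v -> kappa p u v = kappa p v u,
      forall u, tangent p u -> u <> 0 -> 0 < kappa p u u &
      forall A B, vfield_near p A -> vfield_near p B ->
        smooth_at (fun q => kappa q (A q) (B q)) p].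

End Tangent.

Section Cotangent.
Variables (R : realType) (Q : smoothSpace R).

(* Covectors at [q] are extended by 0 to the non-tangent vectors. *)
Definition covector (q : Q) (a : tvec Q -> R) : Prop :=
  (forall (c : R) u v, tangent q u -> tangent q v ->
     a (c *: u + v) = c * a u + a v) /\
  (forall u, ~ tangent q u -> a u = 0).

Definition cot_carrier := {m : Q * (tvec Q -> R) | covector m.1 m.2}.

Definition cot : smoothSpace R :=
  @SmoothSpace R cot_carrier
    [set c | (exists2 a, gens a & c = (fun m => a (sval m).1)) \/
             (exists2 A : Q -> tvec Q, vfield A &
                c = (fun m => (sval m).2 (A (sval m).1)))].

Definition cot_pt (m : cot) : Q := (sval m).1.
Definition cot_mom (m : cot) : tvec Q -> R := (sval m).2.

Definition Theta_Q : form1 cot := fun m v => cot_mom m (push cot_pt m v).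

Definition Omega_Q : form2 cot := fun m u v => - ext_d Theta_Q m u v.

End Cotangent.

Record lieGroup (R : realType) := LieGroup {
  lg_group :> groupType;
  lg_gens : set (lg_group -> R);
  lg_dim : nat;
  lg_manifold : is_manifold lg_dim (SmoothSpace lg_gens);
  lg_smooth :
    @smooth_map R (prod_space (SmoothSpace lg_gens) (SmoothSpace lg_gens))
      (SmoothSpace lg_gens) (fun x => (x.1 * x.2^-1)%g) }.

Definition lg_space (R : realType) (G : lieGroup R) : smoothSpace R :=
  SmoothSpace (@lg_gens R G).

Section LieAlgebra.
Variables (R : realType) (G : lieGroup R).

Definition lalg : set (tvec (lg_space G)) :=
  tangent (1%g : lg_space G).

Definition left_inv (eta : tvec (lg_space G)) :
    lg_space G -> tvec (lg_space G) :=
  fun g => @push R (lg_space G) (lg_space G)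
             (fun h : G => (g * h)%g) 1%g eta.

Definition lalg_bracket (eta theta : tvec (lg_space G)) : tvec (lg_space G) :=
  lie_bracket (left_inv eta) (left_inv theta) 1%g.

End LieAlgebra.

Section Action.
Variables (R : realType) (Q : smoothSpace R) (G : lieGroup R).
Variable act : G -> Q -> Q.
Local Notation galg := (tvec (lg_space G)).

Definition smooth_action : Prop :=
  [/\ forall q, act 1%g q = q,
      forall g h q, act (g * h)%g q = act g (act h q) &
      @smooth_map R (prod_space (lg_space G) Q) Q (fun x => act x.1 x.2)].

Definition free_action : Prop := forall g q, act g q = q -> g = 1%g.

Definition proper_action : Prop :=
  forall K : set (prod_space Q Q), compact K ->
    @compact (prod_space (lg_space G) Q) [set x | K (x.2, act x.1 x.2)].

Definition orbit_space : smoothSpace R :=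
  @SmoothSpace R {O : set Q | exists q, O = range (act^~ q)}
    [set c | smooth (fun q => c (exist _ (range (act^~ q))
                                   (ex_intro _ q erefl)))].

Definition rho (q : Q) : orbit_space :=
  exist _ (range (act^~ q)) (ex_intro _ q erefl).

(* The infinitesimal generator eta_Q(q): the image of eta under the tangent map
   at 1 of g |-> g.q; no exponential map is needed. *)
Definition generator (eta : galg) (q : Q) : tvec Q :=
  @push R (lg_space G) Q (fun g => act g q) 1%g eta.

Definition vertical (q : Q) : set (tvec Q) :=
  [set v | exists2 eta, lalg eta & v = generator eta q].

Definition gsection (xi : Q -> galg) : Prop :=
  (forall q, lalg (xi q)) /\
  (forall f : lg_space G -> R, smooth_at f 1%g -> smooth (fun q => xi q f)).

Definition gen_section (xi : Q -> galg) : Q -> tvec Q :=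
  fun q => generator (xi q) q.

(* The bracket of the action Lie algebroid with anchor xi |-> xi_Q.  For a left
   action eta |-> eta_Q is an anti-homomorphism for the bracket of
   left-invariant fields on G, hence the sign of the first term.  Derivatives of
   g-valued functions are taken componentwise: elements of g are functionals. *)
Definition algebroid_bracket (xi theta : Q -> galg) : Q -> galg := fun q f =>
  - lalg_bracket (xi q) (theta q) f
  + gen_section xi q (fun q' => theta q' f)
  - gen_section theta q (fun q' => xi q' f).

Definition ginvariant_section (xi : Q -> galg) : Prop :=
  forall eta, lalg eta -> forall q, algebroid_bracket xi (fun=> eta) q = 0.

Definition ginvariant_field (A : Q -> tvec Q) : Prop :=
  forall g q, push (act g) q (A q) = A (act g q).

Definition gform1 := Q -> tvec Q -> galg.

Definition is_gform1 (A : gform1) : Prop :=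
  (forall q v, tangent q v -> lalg (A q v)) /\
  (forall f : lg_space G -> R, smooth_at f 1%g -> one_form (fun q v => A q v f)).

Definition gext_d (A : gform1) : Q -> tvec Q -> tvec Q -> galg :=
  fun q u v f => ext_d (fun q' w => A q' w f) q u v.

End Action.

Record nhSystem (R : realType) := NHSystem {
  nh_Q : smoothSpace R;
  nh_dim : nat;
  nh_manifold : is_manifold nh_dim nh_Q;
  nh_kappa : nh_Q -> tvec nh_Q -> tvec nh_Q -> R;
  nh_riemannian : riemannian nh_kappa;
  nh_U : nh_Q -> R;
  nh_U_smooth : smooth nh_U;
  nh_D : nh_Q -> set (tvec nh_Q);
  nh_rank : nat;
  nh_distribution : distribution nh_rank nh_D;
  nh_nonintegrable : ~ integrable_dist nh_rank nh_D }.

Section Nonholonomic.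
Variables (R : realType) (N : nhSystem R).
Local Notation Q := (nh_Q N).
Local Notation kappa := (@nh_kappa R N).
Local Notation D := (@nh_D R N).

Definition lagrangian (q : Q) (v : tvec Q) : R :=
  2^-1 * kappa q v v - nh_U q.

Definition Leg (q : Q) (v : tvec Q) : tvec Q -> R := fun w =>
  if `[< tangent q w >]
  then derive1 (fun t : R => lagrangian q (v + t *: w) : R^o) 0 else 0.

Definition hamiltonian (m : cot Q) : R :=
  let v := get [set v | tangent (cot_pt m) v /\
                        Leg (cot_pt m) v = cot_mom m] in
  cot_mom m v - lagrangian (cot_pt m) v.

Definition Mset : set (cot Q) :=
  [set m | exists2 v, D (cot_pt m) v & cot_mom m = Leg (cot_pt m) v].

Definition M : smoothSpace R := sub_space Mset.

Definition iotaM (m : M) : cot Q := incl m.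
Definition tauM (m : M) : Q := cot_pt (iotaM m).
Definition momM (m : M) : tvec Q -> R := cot_mom (iotaM m).

Definition Theta_M : form1 M := pull1 iotaM (@Theta_Q R Q).
Definition Omega_M : form2 M := pull2 iotaM (@Omega_Q R Q).
Definition H_M (m : M) : R := hamiltonian (iotaM m).

Definition Cdist (m : M) : set (tvec M) :=
  [set v | tangent m v /\ D (tauM m) (push tauM m v)].

(* The vector field X_f; it is unique as Omega_M is nondegenerate on C. *)
Definition nh_field (f : M -> R) : M -> tvec M := fun m =>
  get [set v | Cdist m v /\ forall w, Cdist m w -> Omega_M m v w = w f].

Definition nh_bracket (g f : M -> R) : M -> R := fun m => nh_field f m g.

Definition X_nh : M -> tvec M := fun m f => nh_bracket f H_M m.

Definition first_integral (f : M -> R) : Prop := forall m, X_nh m f = 0.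

Variables (G : lieGroup R) (act : G -> Q -> Q).
Local Notation galg := (tvec (lg_space G)).

Definition g_symmetry : Prop :=
  [/\ smooth_action act, free_action act, proper_action act,
      (forall g q v, D q v -> D (act g q) (push (act g) q v)) &
      (forall g q v, tangent q v ->
         lagrangian (act g q) (push (act g) q v) = lagrangian q v)].

Definition Sdist (q : Q) : set (tvec Q) := D q `&` vertical act q.

Definition gS (q : Q) : set galg :=
  [set eta | lalg eta /\ Sdist q (generator act eta q)].

Definition Hdist (q : Q) : set (tvec Q) :=
  [set v | D q v /\ forall s, Sdist q s -> kappa q v s = 0].

Definition section_gS (xi : Q -> galg) : Prop :=
  gsection xi /\ forall q, gS q (xi q).

Definition basis_gS (k : nat) (xi : 'I_k -> Q -> galg) : Prop :=
  (forall i, section_gS (xi i)) /\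
  (forall q, basis_of (gS q) (fun i => xi i q)).

Definition condA1 : Prop :=
  forall q v, tangent q v ->
    exists d w, [/\ D q d, vertical act q w & v = d + w].

Definition condA2 : Prop := exists k (xi : 'I_k -> Q -> galg), basis_gS xi.

Definition condA3 : Prop := proper_action act /\ free_action act.

Definition condA4 : Prop := is_manifold 1 (orbit_space act).

Definition section_S (Y : Q -> tvec Q) : Prop :=
  vfield Y /\ forall q, Sdist q (Y q).

Definition strong_invariant : Prop :=
  forall Y1 Y2 Y3 : Q -> tvec Q,
    section_S Y1 -> section_S Y2 -> section_S Y3 ->
    ginvariant_field act Y1 -> ginvariant_field act Y2 ->
    ginvariant_field act Y3 ->
    forall q, kappa q (Y1 q) (lie_bracket Y2 Y3 q)
            = - kappa q (Y3 q) (lie_bracket Y2 Y1 q).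

(* The cotangent lift of the action, restricted to M (which it preserves). *)
Definition act_M (g : G) (m : M) : M :=
  xget m [set m' | tauM m' = act g (tauM m) /\
    forall w, tangent (act g (tauM m)) w ->
      momM m' w = momM m (push (act g^-1%g) (act g (tauM m)) w)].

Definition generator_M (eta : galg) (m : M) : tvec M :=
  @push R (lg_space G) M (fun g => act_M g m) 1%g eta.

Definition gen_section_M (xi : Q -> galg) : M -> tvec M :=
  fun m => generator_M (xi (tauM m)) m.

Definition J (m : M) (eta : galg) : R := Theta_M m (generator_M eta m).

Definition J_of (xi : Q -> galg) (m : M) : R := Theta_M m (gen_section_M xi m).

Definition horizontal_gauge_symmetry (zeta : Q -> galg) : Prop :=
  section_gS zeta /\ first_integral (J_of zeta).

Definition vertical_complement (s : nat) (W : Q -> set (tvec Q)) : Prop :=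
  [/\ distribution s W,
      (forall q, W q `<=` vertical act q),
      (forall q v, tangent q v -> exists d w, [/\ D q d, W q w & v = d + w]) &
      (forall q v, D q v -> W q v -> v = 0)].

Section Complement.
Variable W : Q -> set (tvec Q).

Definition P_D (q : Q) (v : tvec Q) : tvec Q :=
  get [set d | D q d /\ W q (v - d)].

Definition P_W (q : Q) (v : tvec Q) : tvec Q := v - P_D q v.

(* d^C (tau_M^* alpha) *)
Definition dC (alpha : form1 Q) : form2 M :=
  pull2 tauM (fun q u v => ext_d alpha q (P_D q u) (P_D q v)).

Definition is_A_W (A : gform1 Q G) : Prop :=
  is_gform1 A /\
  forall q v, tangent q v -> forall eta, lalg eta ->
    (A q v = eta <-> generator act eta q = P_W q v).

Definition gform2_M := M -> tvec M -> tvec M -> galg.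

Definition calK_W (A : gform1 Q G) : gform2_M := fun m u v =>
  gext_d A (tauM m) (P_D (tauM m) (push tauM m u))
                    (P_D (tauM m) (push tauM m v)).

Definition tensor (omega : form2 M) (xi : Q -> galg) : gform2_M :=
  fun m u v => omega m u v *: xi (tauM m).

Definition J_pair (sigma : gform2_M) : form2 M :=
  fun m u v => J m (sigma m u v).

Definition sigma_HGS (k : nat) (A : gform1 Q G) (zeta : 'I_k -> Q -> galg)
    (Yhgs : 'I_k -> form1 Q) : gform2_M := fun m u v =>
  calK_W A m u v + \sum_i tensor (dC (Yhgs i)) (zeta i) m u v.

Definition B_HGS (k : nat) (A : gform1 Q G) (zeta : 'I_k -> Q -> galg)
    (Yhgs : 'I_k -> form1 Q) : form2 M :=
  J_pair (sigma_HGS A zeta Yhgs).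

End Complement.

Section Frame.
Variables (k : nat) (xi : 'I_k -> Q -> galg) (X0 : Q -> tvec Q).

Definition Yfield (i : 'I_k) : Q -> tvec Q := gen_section act (xi i).

Definition kappa_mx (q : Q) : 'M[R]_k :=
  \matrix_(i, l) kappa q (Yfield i q) (Yfield l q).

Definition Rcoef (i j : 'I_k) (q : Q) : R :=
  \sum_l invmx (kappa_mx q) i l *
    (kappa q (Yfield l q) (lie_bracket (Yfield j) X0 q) +
     kappa q (X0 q) (lie_bracket (Yfield j) (Yfield l) q)).

(* X0 is projectable to the field X0bar on Q/G and generates H. *)
Definition horizontal_generator (X0bar : orbit_space act -> tvec _) : Prop :=
  [/\ vfield X0,
      forall q, basis_of (Hdist q) (fun _ : 'I_1 => X0 q),
      vfield X0bar &
      forall q, push (rho act) q (X0 q) = X0bar (rho act q)].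

(* zeta_l = (rho^* fbar^l_i) xi_i is a basis of Gamma(g_S) of G-invariant
   horizontal gauge symmetries, fbar^1, ..., fbar^k being independent solutions
   of R_ij fbar_j - X0bar(fbar_i) = 0 on Q/G. *)
Definition hgs_basis (X0bar : orbit_space act -> tvec _)
    (fbar : 'I_k -> 'I_k -> orbit_space act -> R)
    (zeta : 'I_k -> Q -> galg) : Prop :=
  [/\ forall l i, smooth (fbar l i),
      (forall l i q, \sum_j Rcoef i j q * fbar l j (rho act q)
                     - X0bar (rho act q) (fbar l i) = 0),
      (forall a : 'I_k -> R, (forall i x, \sum_l a l * fbar l i x = 0) ->
         forall l, a l = 0),
      (forall l q, zeta l q = \sum_i fbar l i (rho act q) *: xi i q) &
      [/\ basis_gS zeta,
          forall l, ginvariant_section act (zeta l) &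
          forall l, horizontal_gauge_symmetry (zeta l)]].

Variable W : Q -> set (tvec Q).

Definition is_Y_HGS (zeta : 'I_k -> Q -> galg) (Yhgs : 'I_k -> form1 Q) :=
  forall i,
  [/\ one_form (Yhgs i),
      forall j q, Yhgs i q (gen_section act (zeta j) q) = (i == j)%:R,
      forall q v, Hdist q v -> Yhgs i q v = 0 &
      forall q v, W q v -> Yhgs i q v = 0].

(* The part X^0, Y^i of the basis dual to {X_0, Y_i, Z_a}: as the Z_a span W, it
   does not depend on their choice and is defined on the whole of Q. *)
Definition dual_XY (X0d : form1 Q) (Yd : 'I_k -> form1 Q) : Prop :=
  [/\ one_form X0d,
      [/\ forall q, X0d q (X0 q) = 1,
          forall j q, X0d q (Yfield j q) = 0 &
          forall q w, W q w -> X0d q w = 0] &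
      forall i,
      [/\ one_form (Yd i),
          forall q, Yd i q (X0 q) = 0,
          forall j q, Yd i q (Yfield j q) = (i == j)%:R &
          forall q w, W q w -> Yd i q w = 0]].

(* A local basis Z_a of W over U, with the remaining part of the dual basis. *)
Definition local_frame_W (s : nat) (U : set Q) (Z : 'I_s -> Q -> tvec Q)
    (eps : 'I_s -> form1 Q) : Prop :=
  [/\ open U,
      forall a, vfield_on U (Z a),
      forall q, U q -> basis_of (W q) (fun a => Z a q) &
      forall a,
      [/\ one_form_on U (eps a),
          forall q, U q -> eps a q (X0 q) = 0,
          forall j q, U q -> eps a q (Yfield j q) = 0 &
          forall b q, U q -> eps a q (Z b q) = (a == b)%:R]].

End Frame.

End Nonholonomic.

(* Main.v *)
Require Import Defs.
From HB Require Import structures.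
From mathcomp Require Import all_boot all_order all_algebra ring.
From mathcomp Require Import all_classical all_reals all_analysis.
Import Order.TTheory GRing.Theory Num.Theory.
Import numFieldNormedType.Exports.
Local Open Scope classical_set_scope.
Local Open Scope ring_scope.

(* Put f^l_i = fbar^l_i o rho, so that zeta_l = f^l_i xi_i; dually
   Y^i = f^l_i Y^l_HGS, hence dY^i = f^l_i dY^l_HGS + df^l_i /\ Y^l_HGS.  The f^l_i
   are constant along the orbits, so on D the ODE satisfied by the fbar^l gives
   df^l_i = R_ij f^l_j X^0, and therefore
     dY^i (x) xi_i = dY^l_HGS (x) zeta_l + R_ij X^0 /\ Y^j (x) xi_i   on D.
   Pairing with J gives the first formula.  For the second one,
   A_W = eps^a A_W(Z_a) and eps^a vanishes on D, so K_W = deps^a A_W(Z_a) on D,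
   while A_W(Z_a) generates Z_a. *)

(** Vectors tangent to M enter the formulas only through T tau followed by [P_D]; for X^0 and Y^j,
    which vanish on W, inserting [P_D] changes nothing. So all differentiation happens on Q, on
    pairs of vectors of D. This suits two encodings that shape the proof: M is merely a smooth
    space, and [ext_d] uses extensions picked by choice, which exist for vectors of D because a
    local frame of D supplies them. The rules for [ext_d] rest on sums, products and compositions of
    functions smooth at a point; on a manifold these are handled in a chart, where they become C^k
    calculus on R^n. The passage from Y^l_HGS to Y^i uses the matrix f itself: the zeta_l are f
    applied to the xi_i, and dual bases transform contragrediently. In df^l_i /\ Y^l_HGS the factor
    f^l_j released by the ODE recombines with Y^l_HGS into Y^j, so no f survives in the correction
    term. *)

Set Implicit Arguments.
Unset Strict Implicit.

(** * C^k functions on open subsets of R^n *)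

Section CkFunctions.
Variable R : realType.

Lemma near_eq_differentiable (V W : normedModType R) (f g : V -> W) x :
  {near x, f =1 g} -> differentiable f x -> differentiable g x.
Proof.
move=> fg /diff_locallyP[dc df].
(* The first-order expansion of f is valid for g with the same linear part; uniqueness of the
   differential then identifies the two differentials. *)
have dg : g \o shift x = cst (g x) + 'd f x +o_ 0 id.
  apply/eqaddoP => e e0; move/eqaddoP: df => /(_ e e0) H.
  have fgx := nbhs_singleton fg.
  have H' : \forall y \near (0 : V), f (y + x) = g (y + x).
    have := fg; rewrite (near_shift 0) => H2.
    by apply: filterS H2 => y /=; rewrite subr0.
  apply: filterS2 H H' => y /=.
  by rewrite /cst/shift !fctE /= => + <-; rewrite fgx.
have dE := diff_unique dc dg.
by apply/diff_locallyP; split; [rewrite dE|rewrite dE].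
Qed.

Lemma Ck_on_subset n (U V : set 'rV[R]_n) k (F : 'rV[R]_n -> R^o) :
  V `<=` U -> Ck_on U k F -> Ck_on V k F.
Proof.
move=> VU; elim: k F => [|k IH] F /= H; first by move=> x /VU; exact: H.
by case: H => d H; split=> [x /VU|i]; [exact: d|exact: IH].
Qed.

(** Openness turns equality on U into equality near each of its points, so the partial derivatives
    agree on U as well and the induction runs over arbitrary pairs. *)
Lemma Ck_on_eq n (U : set 'rV[R]_n) k (F H : 'rV[R]_n -> R^o) :
  open U -> (forall x, U x -> F x = H x) -> Ck_on U k F -> Ck_on U k H.
Proof.
move=> oU; elim: k F H => [|k IH] F H FH /=.
  move=> cF x Ux; have nFH : \near x, F x = H x.
    by apply: filterS (open_nbhs_nbhs (conj oU Ux)).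
  move: (cF x Ux); rewrite /prop_for /continuous_at (FH _ Ux) => cFx.
  move=> P /cFx; apply: filterS2 nFH => y /=. by move=> ->.
move=> [dF CF].
have nFH x : U x -> \near x, F x = H x.
  by move=> Ux; apply: filterS (open_nbhs_nbhs (conj oU Ux)).
split=> [x Ux|i].
  by apply: near_eq_differentiable (nFH x Ux) _; exact: dF.
by apply: IH (CF i) => x Ux; apply: near_eq_derive; exact: nFH.
Qed.

Lemma Ck_onW n (U : set 'rV[R]_n) k (F : 'rV[R]_n -> R^o) :
  Ck_on U k.+1 F -> Ck_on U k F.
Proof.
elim: k F => [|k IH] F /= [dF H].
  by move=> x Ux; apply: differentiable_continuous; exact: dF.
by split=> // i; exact: IH.
Qed.

Lemma Ck_on_cst n (U : set 'rV[R]_n) k (c : R) :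
  Ck_on U k ((fun=> c) : 'rV[R]_n -> R^o).
Proof.
elim: k c => [|k IH] c /=; first by move=> x _; exact: cst_continuous.
split=> [x _|i]; first exact: differentiable_cst.
suff -> : (fun x => 'D_(delta_mx 0 i) ((fun=> c) : 'rV[R]_n -> R^o) x)
        = (fun=> 0) by exact: IH.
by apply/funext => x; exact: derive_cst.
Qed.

Lemma Ck_onD n (U : set 'rV[R]_n) k (F H : 'rV[R]_n -> R^o) :
  open U -> Ck_on U k F -> Ck_on U k H -> Ck_on U k (fun x => F x + H x).
Proof.
move=> oU; elim: k F H => [|k IH] F H /=.
  by move=> cF cH x Ux; exact: (continuousD (cF x Ux) (cH x Ux)).
move=> [dF CF] [dH CH]; split=> [x Ux|i].
  by apply: differentiableD; [exact: dF|exact: dH].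
apply: Ck_on_eq (IH _ _ (CF i) (CH i)) => // x Ux.
by rewrite -deriveD//; apply: diff_derivable; [exact: dF|exact: dH].
Qed.

Lemma Ck_onM n (U : set 'rV[R]_n) k (F H : 'rV[R]_n -> R^o) :
  open U -> Ck_on U k F -> Ck_on U k H -> Ck_on U k (fun x => F x * H x).
Proof.
move=> oU; elim: k F H => [|k IH] F H.
  by move=> /= cF cH x Ux; exact: (continuousM (cF x Ux) (cH x Ux)).
(* The Leibniz rule leaves one factor undifferentiated, so F and H are also needed at order k. *)
move=> CF CH; have CF' := Ck_onW CF; have CH' := Ck_onW CH.
case: CF CH => dF CF [dH CH]; split=> [x Ux|i].
  by apply: differentiableM; [exact: dF|exact: dH].
apply: Ck_on_eq (Ck_onD oU (IH _ _ CF' (CH i)) (IH _ _ CH' (CF i))) => // x Ux.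
have := @deriveM _ _ F H x (delta_mx 0 i); rewrite /GRing.scale/= => <- //.
  by apply: diff_derivable; exact: dF.
by apply: diff_derivable; exact: dH.
Qed.

Lemma Ck_on_sum n (U : set 'rV[R]_n) k m (F : 'I_m -> 'rV[R]_n -> R^o) :
  open U -> (forall i, Ck_on U k (F i)) -> Ck_on U k (fun x => \sum_i F i x).
Proof.
move=> oU; elim: m F => [|m IH] F CF.
  by apply: Ck_on_eq (Ck_on_cst U k 0) => // x _; rewrite big_ord0.
apply: Ck_on_eq (Ck_onD oU (CF ord0) (IH _ (fun i => CF (lift ord0 i)))) => //.
by move=> x _; rewrite big_ord_recl.
Qed.

Lemma Ck_on_coord n (U : set 'rV[R]_n) k (i : 'I_n) :
  Ck_on U k (fun z => z 0 i).
Proof.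
case: k => [|k] /=; first by move=> x _; exact: coord_continuous.
split=> [x _|j]; first exact: differentiable_coord.
suff -> : (fun x => 'D_(delta_mx 0 j) (fun z : 'rV[R]_n => z 0 i : R^o) x)
        = (fun=> (delta_mx 0 j : 'rV[R]_n) 0 i) by exact: Ck_on_cst.
apply/funext => x; rewrite deriveE; last exact: differentiable_coord.
(* A coordinate is linear, hence its own differential; it is bundled as a linear map for
   [diff_lin]. *)
have lin : linear (fun z : 'rV[R]_n => z 0 i : R^o).
  by move=> a u v; rewrite !mxE.
pose linM := GRing.isLinear.Build _ _ _ _ _ lin.
pose f : {linear 'rV[R]_n -> R^o} := HB.pack (fun z : 'rV[R]_n => z 0 i : R^o) linM.
by rewrite (@diff_lin _ _ _ f)//; exact: coord_continuous.
Qed.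

(** Presents a row-valued map as a sum of scalar functions times constant vectors, so that
    continuity and derivatives reduce to the components. *)
Lemma row_sum_delta_mx (T : Type) m (C : 'I_m -> T -> R) :
  (fun y => \row_j C j y) = \sum_j (fun y => C j y *: (delta_mx 0 j : 'rV[R]_m)).
Proof.
apply/funext => y; rewrite fct_sumE [LHS]row_sum_delta.
by apply: eq_bigr => j _; rewrite mxE.
Qed.

Lemma differentiable_row n m (C : 'I_m -> 'rV[R]_n -> R^o) x :
  (forall j, differentiable (C j) x) ->
  differentiable (fun y => \row_j C j y : 'rV[R]_m) x.
Proof.
move=> dC.
rewrite row_sum_delta_mx.
by apply: differentiable_sum => j; exact: differentiableZl.
Qed.

Lemma continuous_row (T : topologicalType) m (C : 'I_m -> T -> R^o) x :
  (forall j, {for x, continuous (C j)}) ->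
  {for x, continuous (fun y => \row_j C j y : 'rV[R]_m)}.
Proof.
move=> cC.
rewrite row_sum_delta_mx.
elim/big_ind: _ => [||j _].
- exact: cst_continuous.
- by move=> f g cf cg; exact: continuousD.
- by apply: continuousZr_tmp; exact: cC.
Qed.

(** Chain rule: the i-th partial derivative is the sum over j of (d_j F) o C times d_i C_j; the
    induction hypothesis is applied to each d_j F with the same inner map. *)
Lemma Ck_on_comp n m (U : set 'rV[R]_n) (V : set 'rV[R]_m) k
    (F : 'rV[R]_m -> R^o) (C : 'I_m -> 'rV[R]_n -> R^o) :
  open U -> (forall x, U x -> V (\row_j C j x)) ->
  Ck_on V k F -> (forall j, Ck_on U k (C j)) ->
  Ck_on U k (fun x => F (\row_j C j x)).
Proof.
move=> oU CUV; elim: k F => [|k IH] F.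
  move=> cF cC x Ux.
  apply: (@continuous_comp _ _ _ (fun x => \row_j C j x)).
    by apply: continuous_row => j; exact: cC.
  by apply: cF; exact: CUV.
move=> [dF CF] CC; split=> [x Ux|i].
  apply: (@differentiable_comp _ _ _ _ (fun x => \row_j C j x)).
    by apply: differentiable_row => j; case: (CC j) => d _; exact: d.
  by apply: dF; exact: CUV.
have CC' j : Ck_on U k (C j) by apply: Ck_onW; exact: CC.
apply: Ck_on_eq (Ck_on_sum oU (fun j =>
  Ck_onM oU (IH _ (CF j) CC') ((CC j).2 i))) => // x Ux.
have dC j : differentiable (C j) x by exact: (CC j).1.
have dr := differentiable_row dC.
have dFx : differentiable F (\row_j C j x) by apply: dF; exact: CUV.
rewrite [RHS]deriveE; last exact: (differentiable_comp dr dFx).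
rewrite (diff_comp dr dFx) /=.
have -> : 'd (fun y => \row_j C j y : 'rV[R]_m) x (delta_mx 0 i)
   = \sum_j 'D_(delta_mx 0 i) (C j) x *: (delta_mx 0 j : 'rV[R]_m).
  rewrite (row_sum_delta_mx C) -deriveE; last by rewrite -row_sum_delta_mx.
  rewrite derive_sum => [|j]; last first.
    by apply: diff_derivable; exact: differentiableZl.
  apply: eq_bigr => j _.
  rewrite deriveE; last exact: differentiableZl.
  by rewrite diffZl//= deriveE.
rewrite linear_sum; apply: eq_bigr => j _.
by rewrite linearZ /= -deriveE// mulrC.
Qed.

End CkFunctions.

(** * Smooth functions and smooth maps at a point *)

Section SmoothFunctions.
Variable R : realType.

Lemma gens_continuous (X : smoothSpace R) (a : X -> R) :
  gens a -> continuous a.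
Proof.
move=> ga p.
have c1 : {for p, continuous (@eval_gens R X)} by exact: initial_continuous.
move=> A aA; have /cvg_sup/(_ (exist _ a ga)) H : eval_gens p --> eval_gens p.
  exact: cvg_id.
apply: (c1 [set f | A (f (exist _ a ga))]); apply: H.
exact: (@initial_continuous _ _ (fun f : (forall i, _) => f (exist _ a ga))).
Qed.

(** The topology of X is initial for [eval_gens], and a map into the product is continuous when its
    components, here the generators, are. *)
Lemma continuous_to_smoothSpace (T : topologicalType) (X : smoothSpace R)
    (phi : T -> X) t :
  (forall a, gens a -> {for t, continuous (a \o phi)}) ->
  {for t, continuous phi}.
Proof.
move=> H.
suff He : {for t, continuous (@eval_gens R X \o phi)}.
  move=> A; rewrite nbhsE => -[B [[C oC <-] Cp] BA].
  have HC : nbhs t (phi @^-1` (@eval_gens R X @^-1` C)).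
    by apply: (He C); apply: open_nbhs_nbhs; split=> //; exists C.
  by apply: filterS HC => y; exact: BA.
have Ff : Filter (@eval_gens R X \o phi @ t) by exact: fmap_filter.
rewrite /prop_for /continuous_at; apply: (iffRL (cvg_sup _ _ Ff)) => -[a ga] A.
rewrite nbhsE => -[B [[C oC <-] Cp] BA].
have HC : nbhs t ((a \o phi) @^-1` C).
  by apply: (H a ga C); apply: open_nbhs_nbhs; split.
by apply: filterS HC => y; exact: BA.
Qed.

Lemma Cinf_near_continuous n (F : 'rV[R]_n -> R^o) x :
  Cinf_near F x -> {for x, continuous F}.
Proof. by case=> U [_ Ux /(_ 0)]; exact. Qed.

Lemma smooth_at_continuous (X : smoothSpace R) (f : X -> R) p :
  smooth_at f p -> {for p, continuous f}.
Proof.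
move=> [m [c [F [gc cF nf]]]].
have cFc : {for p, continuous (fun y => F (\row_i c i y))}.
  apply: (@continuous_comp _ _ _ (fun y => \row_i c i y)).
    by apply: continuous_row => j; exact: gens_continuous.
  exact: Cinf_near_continuous.
move=> A; rewrite (nbhs_singleton nf) => /cFc H.
have H' : nbhs p [set y | A (F (\row_i c i y))] by exact: H.
by apply: filterS2 nf H' => y /= ->.
Qed.

Lemma smooth_at_near (X : smoothSpace R) (f g : X -> R) p :
  (\forall x \near p, f x = g x) -> smooth_at f p -> smooth_at g p.
Proof.
move=> fg [m [c [F [gc cF nf]]]]; exists m, c, F; split=> //.
by apply: filterS2 fg nf => y <-.
Qed.

(** Trades the finitely many generators, which vary with the function, for the coordinates of one
    chart. *)
Lemma chart_smooth_at n (X : smoothSpace R) (p : X) : is_manifold n X ->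
  exists x : X -> 'rV[R]_n,
    [/\ {for p, continuous x} & forall f, smooth_at f p <->
     exists2 F : 'rV[R]_n -> R^o,
       Cinf_near F (x p) & \forall y \near p, f y = F (x y)].
Proof.
move=> [_ _ /(_ p)[U [x [Up [oU injx oUx sx]]]]]; exists x; split; last first.
  by move=> f; exact: sx.
move=> A; rewrite nbhsE => -[B [oB Bxp] BA].
(* The chart condition compares open sets with their images, so continuity of x is obtained by
   computing the image of the candidate neighbourhood. *)
have xV : x @` (U `&` x @^-1` B) = x @` U `&` B.
  apply/seteqP; split=> z; first by move=> [y [Uy By] <-]; split=> //; exists y.
  by move=> [[y Uy <-] By]; exists y.
have oV : open (U `&` x @^-1` B).
  apply/(oUx _ (@subIsetl _ _ _)); rewrite xV; apply: openI => //.
  by apply/(oUx _ (@subset_refl _ _)).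
have nV : nbhs p (U `&` x @^-1` B) by exact: open_nbhs_nbhs.
by apply: filterS nV => y [_ By]; exact: BA.
Qed.

Definition smooth_map_at (X Y : smoothSpace R) (phi : X -> Y) (p : X) :=
  forall f : Y -> R, smooth_at f (phi p) -> smooth_at (f \o phi) p.

Lemma gens_smooth_at (X : smoothSpace R) (a : X -> R) p :
  gens a -> smooth_at a p.
Proof.
move=> ga; exists 1%N, (fun=> a), (fun z : 'rV[R]_1 => z 0 0); split=> //.
- exists setT; split=> [||k]; [exact: openT|by []|].
  exact: Ck_on_coord.
- by apply: filterE => y; rewrite mxE.
Qed.

Lemma smooth_map_at_continuous (X Y : smoothSpace R) (phi : X -> Y) p :
  smooth_map_at phi p -> {for p, continuous phi}.
Proof.
move=> sphi; apply: continuous_to_smoothSpace => a ga.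
by apply: smooth_at_continuous; apply: sphi; exact: gens_smooth_at.
Qed.

(* Unlike [smooth_map_at_smooth_gens], this applies to [tauM]: [M] is not known to
   be a manifold. *)
Lemma smooth_map_at_gens (X Y : smoothSpace R) (phi : X -> Y) p :
  (forall a, gens a -> gens (a \o phi)) -> smooth_map_at phi p.
Proof.
move=> gphi f [m [c [F [gc cF nf]]]].
have cphi : {for p, continuous phi}.
  by apply: continuous_to_smoothSpace => a /gphi ga; exact: gens_continuous.
exists m, (fun i => c i \o phi), F; split=> // [i|]; first exact: gphi.
exact: (cphi _ nf).
Qed.

Section OnManifold.
Variables (n : nat) (X : smoothSpace R).
Hypothesis mX : is_manifold n X.

(** In a chart each c_i becomes a smooth C_i of the coordinates, and the composite is F applied to
    the row of the C_i, a matter for [Ck_on_comp]. *)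
Lemma smooth_at_comp_Cinf p m (F : 'rV[R]_m -> R^o) (c : 'I_m -> X -> R) :
  (forall i, smooth_at (c i) p) -> Cinf_near F (\row_i c i p) ->
  smooth_at (fun y => F (\row_i c i y)) p.
Proof.
move=> sc [V [oV Vp CF]].
have [x [cx sx]] := chart_smooth_at p mX.
have /choice[C HC] i : exists C : 'rV[R]_n -> R^o, Cinf_near C (x p) /\
    \forall y \near p, c i y = C (x y).
  by have [+ _] := sx (c i) => /(_ (sc i))[C ? ?]; exists C.
have /choice[U HU] i : exists U, [/\ open U, U (x p) & forall k, Ck_on U k (C i)].
  by have [[U ?] _] := HC i; exists U.
apply/sx; exists (fun z => F (\row_i C i z)); last first.
  have : \forall y \near p, forall i, c i y = C i (x y).
    have := @filter_forall _ _ (fun i y => c i y = C i (x y)) (nbhs p) _.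
    by apply => i; exact: (HC i).2.
  apply: filterS => y cE; congr F.
  by apply/rowP => i; rewrite !mxE.
(* The region where all C_i are smooth and their row stays in V. It is only known to be a
   neighbourhood of x p, hence the passage to its interior. *)
pose U0 := [set z | forall i, U i z] `&` (fun z => \row_i C i z) @^-1` V.
have cC : {for x p, continuous (fun z => \row_i C i z)}.
  by apply: continuous_row => i; exact: Cinf_near_continuous (HC i).1.
have nU0 : nbhs (x p) U0.
  apply: filterI.
    have := @filter_forall _ _ U (nbhs (x p)) _; apply => i.
    by have [? ? _] := HU i; exact: open_nbhs_nbhs.
  apply: cC; apply: open_nbhs_nbhs; split=> //=.
  suff <- : \row_i c i p = \row_i C i (x p) by [].
  by apply/rowP => i; rewrite !mxE (nbhs_singleton (HC i).2).
exists U0°; split; [exact: open_interior|exact: nU0|] => k.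
have sub : U0° `<=` U0 by exact: interior_subset.
apply: (@Ck_on_comp _ _ _ _ V) => //.
- exact: open_interior.
- by move=> z /sub[].
- move=> j; have [_ _ Cj] := HU j.
  by apply: Ck_on_subset (Cj k) => z /sub[+ _]; exact.
Qed.

(** The chart puts f and g over the same variables, whereas the generators that define them may
    differ. *)
Lemma smooth_atD p (f g : X -> R) :
  smooth_at f p -> smooth_at g p -> smooth_at (fun y => f y + g y) p.
Proof.
have [x [cx sx]] := chart_smooth_at p mX.
move=> /sx[F [U [oU Ux CF]] nF] /sx[H [V [oV Vx CH]] nH]; apply/sx.
exists (fun z => F z + H z); last by apply: filterS2 nF nH => y -> ->.
exists (U `&` V); split=> [||k]; [exact: openI|by []|].
apply: Ck_onD; first exact: openI.
  by apply: Ck_on_subset (CF k) => ? [].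
by apply: Ck_on_subset (CH k) => ? [].
Qed.

Lemma smooth_atM p (f g : X -> R) :
  smooth_at f p -> smooth_at g p -> smooth_at (fun y => f y * g y) p.
Proof.
have [x [cx sx]] := chart_smooth_at p mX.
move=> /sx[F [U [oU Ux CF]] nF] /sx[H [V [oV Vx CH]] nH]; apply/sx.
exists (fun z => F z * H z); last by apply: filterS2 nF nH => y -> ->.
exists (U `&` V); split=> [||k]; [exact: openI|by []|].
apply: Ck_onM; first exact: openI.
  by apply: Ck_on_subset (CF k) => ? [].
by apply: Ck_on_subset (CH k) => ? [].
Qed.

Lemma smooth_at_cst p (c : R) : smooth_at ((fun=> c) : X -> R) p.
Proof.
have [x [cx sx]] := chart_smooth_at p mX; apply/sx.
exists (fun=> c); last exact: filterE.
by exists setT; split=> [||k]; [exact: openT|by []|exact: Ck_on_cst].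
Qed.

Lemma smooth_at_sum p m (f : 'I_m -> X -> R) :
  (forall i, smooth_at (f i) p) -> smooth_at (fun y => \sum_i f i y) p.
Proof.
elim: m f => [|m IH] f sf.
  apply: smooth_at_near (smooth_at_cst p 0).
  by apply: filterE => y; rewrite big_ord0.
apply: smooth_at_near (smooth_atD (sf ord0) (IH _ (fun i => sf (lift ord0 i)))).
by apply: filterE => y; rewrite big_ord_recl.
Qed.

(** A function smooth at phi p is locally F of generators, so it suffices that the pulled-back
    generators be smooth, not that they be generators again. *)
Lemma smooth_map_at_smooth_gens (Y : smoothSpace R) (phi : X -> Y) p :
  (forall a, gens a -> smooth_at (a \o phi) p) -> smooth_map_at phi p.
Proof.
move=> gphi f [m [c [F [gc cF nf]]]].
have cphi : {for p, continuous phi}.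
  apply: continuous_to_smoothSpace => a /gphi; exact: smooth_at_continuous.
apply: smooth_at_near (smooth_at_comp_Cinf (fun i => gphi _ (gc i)) cF).
have H : nbhs p (phi @^-1` [set y | f y = F (\row_i c i y)]) by exact: (cphi _ nf).
by apply: filterS H => y /= ->.
Qed.

End OnManifold.
End SmoothFunctions.

(** * Tangent vectors, 1-forms and the exterior derivative *)

Section TangentVectors.
Variable R : realType.
Implicit Types X Y : smoothSpace R.

Lemma tangentZD X (p : X) (a : R) (u v : tvec X) :
  tangent p u -> tangent p v -> tangent p (a *: u + v).
Proof.
move=> [lu mu nu zu] [lv mv nv zv]; split=> [b f g sf sg|f g sf sg|f g fg|f sf];
  rewrite !fctE.
- by rewrite lu// lv// /GRing.scale/=; ring.
- by rewrite mu// mv// /GRing.scale/=; ring.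
- by rewrite (nu _ _ fg) (nv _ _ fg).
- by rewrite zu// zv// scaler0 addr0.
Qed.

Lemma tangent0 X (p : X) : tangent p (0 : tvec X).
Proof.
have z f : (0 : tvec X) f = 0 by [].
by split=> *; rewrite !z ?mulr0 ?addr0.
Qed.

Lemma tangentZ X (p : X) (a : R) (u : tvec X) :
  tangent p u -> tangent p (a *: u).
Proof. by move=> tu; rewrite -[_ *: _]addr0; apply: tangentZD tu (tangent0 p). Qed.

Lemma tangentD X (p : X) (u v : tvec X) :
  tangent p u -> tangent p v -> tangent p (u + v).
Proof. by move=> tu tv; rewrite -[u]scale1r; apply: tangentZD tu tv. Qed.

Lemma tangentB X (p : X) (u v : tvec X) :
  tangent p u -> tangent p v -> tangent p (u - v).
Proof. by move=> tu tv; rewrite addrC -scaleN1r; apply: tangentZD tv tu. Qed.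

Lemma tangent_sum X (p : X) m (u : 'I_m -> tvec X) :
  (forall i, tangent p (u i)) -> tangent p (\sum_i u i).
Proof.
by move=> tu; apply: big_ind => // [|? ? ? ?]; [exact: tangent0|exact: tangentD].
Qed.

Lemma push_linear X Y (phi : X -> Y) (p : X) (a : R) (u v : tvec X) :
  push phi p (a *: u + v) = a *: push phi p u + push phi p v.
Proof.
apply/funext => f; rewrite !fctE /push; case: ifP => // _.
by rewrite scaler0 addr0.
Qed.

Lemma push0 X Y (phi : X -> Y) (p : X) : push phi p 0 = 0.
Proof. by apply/funext => f; rewrite /push; case: ifP. Qed.

Lemma push_sum X Y (phi : X -> Y) (p : X) m (a : 'I_m -> R) (u : 'I_m -> tvec X) :
  push phi p (\sum_i a i *: u i) = \sum_i a i *: push phi p (u i).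
Proof.
elim: m a u => [|m IH] a u; first by rewrite !big_ord0 push0.
by rewrite !big_ord_recl push_linear IH.
Qed.

(** The manifold hypothesis sits on the target, where sums and products must be smooth to select the
    right branch of [push]; the source may thus be M. *)
Lemma tangent_push n X Y (phi : X -> Y) (p : X) (v : tvec X) :
  is_manifold n Y -> smooth_map_at phi p -> tangent p v -> tangent (phi p) (push phi p v).
Proof.
move=> mY sphi [lv mv nv zv]; have cphi := smooth_map_at_continuous sphi;
  split=> [a f g sf sg|f g sf sg|f g fg|f sf];
  rewrite /push.
- rewrite !asboolT// ?(lv _ (f \o phi))//; try exact: sphi.
  have sc := smooth_at_cst mY (phi p) a.
  by apply: (smooth_atD mY _ sg); exact: (smooth_atM mY sc sf).
- rewrite !asboolT// ?(mv (f \o phi))//; try exact: sphi.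
  exact: (smooth_atM mY sf sg).
- have -> : `[< smooth_at f (phi p) >] = `[< smooth_at g (phi p) >].
    apply: asbool_equiv_eq; split; apply: smooth_at_near => //.
    by apply: filterS fg.
  by rewrite (nv (f \o phi) (g \o phi))//; exact: (cphi _ fg).
- by rewrite asboolF.
Qed.

Section OneForms.
Variables (X : smoothSpace R) (U : set X) (alpha : form1 X) (p : X).
Hypotheses (Up : U p) (Ha : one_form_on U alpha).

Lemma one_form_onP (a : R) u v : tangent p u -> tangent p v ->
  alpha p (a *: u + v) = a * alpha p u + alpha p v.
Proof. by have [H _] := Ha Up; exact: H. Qed.

Lemma one_form_on0 : alpha p 0 = 0.
Proof.
have := one_form_onP 1 (tangent0 p) (tangent0 p).
by rewrite scale1r addr0 mul1r => /(congr1 (fun z => z - alpha p 0)); rewrite subrr addrK.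
Qed.

Lemma one_form_onD u v : tangent p u -> tangent p v ->
  alpha p (u + v) = alpha p u + alpha p v.
Proof. by move=> tu tv; have := one_form_onP 1 tu tv; rewrite scale1r mul1r. Qed.

Lemma one_form_on_sum m (a : 'I_m -> R) (u : 'I_m -> tvec X) :
  (forall i, tangent p (u i)) ->
  alpha p (\sum_i a i *: u i) = \sum_i a i * alpha p (u i).
Proof.
elim: m a u => [|m IH] a u tu; first by rewrite !big_ord0 one_form_on0.
rewrite !big_ord_recl one_form_onP ?IH//.
by apply: tangent_sum => i; exact: tangentZ.
Qed.

End OneForms.

Section OnManifold.
Variables (n : nat) (X : smoothSpace R).
Hypothesis mX : is_manifold n X.

Lemma tangent_cst (p : X) (v : tvec X) c : tangent p v -> v (fun=> c) = 0.
Proof.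
move=> tv.
have v1 : v (fun=> 1) = 0.
  have [_ mv _ _] := tv; have s1 := smooth_at_cst mX p 1.
  have := mv _ _ s1 s1; rewrite !mul1r.
  by move=> /(congr1 (fun z => z - v (fun=> 1))); rewrite addrK subrr.
have [lv _ _ _] := tv; have s1 := smooth_at_cst mX p 1.
(* The linearity axiom has the shape a f + g and only v 1 = 0 is known so far, so c is written (c -
   1) 1 + 1. *)
have := lv (c - 1) _ _ s1 s1; rewrite v1 mulr0 addr0.
suff -> : (fun _ : X => (c - 1) * 1 + 1) = (fun=> c) by [].
by apply/funext => x; rewrite mulr1 subrK.
Qed.

Lemma tangent_evalD (p : X) (v : tvec X) f g : tangent p v ->
  smooth_at f p -> smooth_at g p -> v (fun x => f x + g x) = v f + v g.
Proof.
move=> [lv _ _ _] sf sg; have := lv 1 _ _ sf sg; rewrite mul1r => <-.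
by congr v; apply/funext => x; rewrite mul1r.
Qed.

Lemma tangent_eval_sum (p : X) (v : tvec X) m (f : 'I_m -> X -> R) :
  tangent p v -> (forall i, smooth_at (f i) p) ->
  v (fun x => \sum_i f i x) = \sum_i v (f i).
Proof.
move=> tv; elim: m f => [|m IH] f sf.
  rewrite big_ord0; transitivity (v (fun=> 0)); last exact: (tangent_cst 0 tv).
  by congr v; apply/funext => x; rewrite big_ord0.
rewrite big_ord_recl -IH// -(tangent_evalD tv)//.
  by congr v; apply/funext => x; rewrite big_ord_recl.
exact: (smooth_at_sum mX (fun i => sf (lift ord0 i))).
Qed.

Lemma vfield_near_nbhs (p : X) (A : X -> tvec X) : vfield_near p A ->
  \forall q \near p, tangent q (A q) /\
    forall f, smooth_at f q -> smooth_at (fun q => A q f) q.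
Proof.
move=> [U [oU Up vA]]; apply: filterS (open_nbhs_nbhs (conj oU Up)) => q.
exact: vA.
Qed.

Lemma smooth_at_nbhs (p : X) (f : X -> R) : smooth_at f p ->
  \forall q \near p, smooth_at f q.
Proof.
move=> [m [c [F [gc [V [oV Vp CF]] nf]]]].
have cc : {for p, continuous (fun y => \row_i c i y)}.
  by apply: continuous_row => j; exact: gens_continuous.
have nV : nbhs p [set y | V (\row_i c i y)].
  by apply: cc; apply: open_nbhs_nbhs.
have nf' := nbhs_interior nf.
apply: filterS2 nV nf' => q Vq fq; exists m, c, F; split=> //.
by exists V.
Qed.

(** A and B are derivations only near p, so their rules are substituted under A p and B p by
    locality. In the Leibniz rule the mixed products of first derivatives cancel. *)
Lemma tangent_lie_bracket (p : X) (A B : X -> tvec X) :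
  vfield_near p A -> vfield_near p B -> tangent p (lie_bracket A B p).
Proof.
move=> vA vB; rewrite /lie_bracket.
have nA := vfield_near_nbhs vA; have nB := vfield_near_nbhs vB.
have [tA sA] := nbhs_singleton nA; have [tB sB] := nbhs_singleton nB.
have [lA mA eA _] := tA; have [lB mB eB _] := tB.
split=> [a f g sf sg|f g sf sg|f g fg|f sf]; last by rewrite asboolF.
- rewrite !asboolT//; last first.
    have sc := smooth_at_cst mX p a.
    by apply: (smooth_atD mX _ sg); exact: (smooth_atM mX sc sf).
  rewrite (eA _ (fun q => a * B q f + B q g)); last first.
    by apply: filterS3 nB (smooth_at_nbhs sf) (smooth_at_nbhs sg)
      => q [[l _ _ _] _] ? ?; exact: l.
  rewrite (eB _ (fun q => a * A q f + A q g)); last first.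
    by apply: filterS3 nA (smooth_at_nbhs sf) (smooth_at_nbhs sg)
      => q [[l _ _ _] _] ? ?; exact: l.
  rewrite lA ?lB; try by [exact: sA|exact: sB].
  by rewrite mulrBr; ring.
- rewrite !asboolT//; last exact: (smooth_atM mX sf sg).
  rewrite (eA _ (fun q => f q * B q g + g q * B q f)); last first.
    by apply: filterS3 nB (smooth_at_nbhs sf) (smooth_at_nbhs sg)
      => q [[_ l _ _] _] ? ?; exact: l.
  rewrite (eB _ (fun q => f q * A q g + g q * A q f)); last first.
    by apply: filterS3 nA (smooth_at_nbhs sf) (smooth_at_nbhs sg)
      => q [[_ l _ _] _] ? ?; exact: l.
  have sAf := sA _ sf; have sAg := sA _ sg; have sBf := sB _ sf; have sBg := sB _ sg.
  rewrite (tangent_evalD tA) ?(tangent_evalD tB); try by apply: (smooth_atM mX).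
  by rewrite !mA// !mB//; ring.
- have -> : `[< smooth_at f p >] = `[< smooth_at g p >].
    apply: asbool_equiv_eq; split; apply: smooth_at_near => //.
    by apply: filterS fg.
  have fg' : \forall q \near p, \forall x \near q, f x = g x.
    exact: nbhs_interior fg.
  rewrite (eA _ (fun q => B q g)); last first.
    by apply: filterS2 nB fg' => q [[_ _ l _] _] ?; exact: l.
  rewrite (eB _ (fun q => A q g)) //.
  by apply: filterS2 nA fg' => q [[_ _ l _] _] ?; exact: l.
Qed.

(** The vectors on which [ext_d] is under control: for any other, the [get] inside [extension]
    returns a default. *)
Definition extensible (p : X) (v : tvec X) :=
  exists A, vfield_near p A /\ A p = v.

Lemma extensionP (p : X) (v : tvec X) : extensible p v ->
  vfield_near p (extension p v) /\ extension p v p = v.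
Proof. by move=> /getPex. Qed.

Lemma extensible_tangent (p : X) (v : tvec X) : extensible p v -> tangent p v.
Proof. by move=> [A [/vfield_near_nbhs/nbhs_singleton[tA _] <-]]. Qed.

(* Both sides use the extensions of [u] and [v] chosen by [extension], so it is
   never needed that [ext_d] does not depend on them. *)
Lemma ext_d_sum (p : X) m (U : set X) (F : 'I_m -> X -> R)
    (beta : 'I_m -> form1 X) (alpha : form1 X) (u v : tvec X) :
  U p -> (forall l, one_form_on U (beta l)) -> (forall l, smooth_at (F l) p) ->
  (\forall q \near p, forall w, tangent q w ->
     alpha q w = \sum_l F l q * beta l q w) ->
  extensible p u -> extensible p v ->
  ext_d alpha p u v =
    \sum_l (u (F l) * beta l p v - v (F l) * beta l p u
             + F l p * ext_d (beta l) p u v).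
Proof.
move=> Up Hb sF Ha /extensionP[vA Au] /extensionP[vB Bv]; rewrite /ext_d.
move: (extension p u) (extension p v) vA Au vB Bv => A B vA Au vB Bv.
have nA := vfield_near_nbhs vA; have nB := vfield_near_nbhs vB.
have [tA _] := nbhs_singleton nA; have [tB _] := nbhs_singleton nB.
have [_ mA eA _] := tA; have [_ mB eB _] := tB.
have sb l C : vfield_near p C -> smooth_at (fun q => beta l q (C q)) p.
  by have [_ H] := Hb l p Up; exact: H.
rewrite (eA _ (fun q => \sum_l F l q * beta l q (B q))); last first.
  by apply: filterS2 nB Ha => q [tq _]; exact.
rewrite (eB _ (fun q => \sum_l F l q * beta l q (A q))); last first.
  by apply: filterS2 nA Ha => q [tq _]; exact.
rewrite (nbhs_singleton Ha); last exact: tangent_lie_bracket.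
have sFb l C : vfield_near p C -> smooth_at (fun q => F l q * beta l q (C q)) p.
  by move=> vC; apply: (smooth_atM mX (sF l)); exact: sb.
rewrite (tangent_eval_sum tA) ?(tangent_eval_sum tB)//; try by move=> l; exact: sFb.
rewrite -!sumrB; apply: eq_bigr => l _.
rewrite mA ?mB//; try exact: sb.
by rewrite -Au -Bv; ring.
Qed.

(** The case of [ext_d_sum] with constant coefficients, whose derivatives vanish. Two terms are what
    the linearity and Leibniz axioms of [tangent] produce, see [gext_d_tangent]. *)
Lemma ext_d_lin2 (p : X) (U : set X) (c1 c2 : R) (alpha beta1 beta2 : form1 X)
    (u v : tvec X) :
  U p -> one_form_on U beta1 -> one_form_on U beta2 ->
  (\forall q \near p, forall w, tangent q w ->
     alpha q w = c1 * beta1 q w + c2 * beta2 q w) ->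
  extensible p u -> extensible p v ->
  ext_d alpha p u v = c1 * ext_d beta1 p u v + c2 * ext_d beta2 p u v.
Proof.
move=> Up H1 H2 Ha eu ev.
pose F (l : 'I_2) (_ : X) := if l == 0 then c1 else c2.
pose beta (l : 'I_2) := if l == 0 then beta1 else beta2.
rewrite (@ext_d_sum p _ U F beta)//; first 1 last.
- by move=> l; rewrite /beta; case: ifP.
- by move=> l; exact: smooth_at_cst mX p _.
- by apply: filterS Ha => q Ha w tw; rewrite !big_ord_recl big_ord0 Ha// addr0.
rewrite !big_ord_recl big_ord0 /F /beta /= !(tangent_cst _ (extensible_tangent eu))
  !(tangent_cst _ (extensible_tangent ev)).
by rewrite !mul0r subrr !add0r addr0.
Qed.

Lemma eq_ext_d (p : X) (alpha beta : form1 X) (u v : tvec X) :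
  (\forall q \near p, forall w, tangent q w -> alpha q w = beta q w) ->
  extensible p u -> extensible p v -> ext_d alpha p u v = ext_d beta p u v.
Proof.
move=> ab /extensionP[vA Au] /extensionP[vB Bv]; rewrite /ext_d.
have nA := vfield_near_nbhs vA; have nB := vfield_near_nbhs vB.
have [[_ _ eA _] _] := nbhs_singleton nA; have [[_ _ eB _] _] := nbhs_singleton nB.
rewrite (nbhs_singleton ab); last exact: tangent_lie_bracket.
congr (_ - _ - _).
  by apply: eA; apply: filterS2 nB ab => q [tq _]; exact.
by apply: eB; apply: filterS2 nA ab => q [tq _]; exact.
Qed.

Lemma ext_d_eq0 (p : X) (alpha : form1 X) (u v : tvec X) :
  (\forall q \near p, forall w, tangent q w -> alpha q w = 0) ->
  extensible p u -> extensible p v -> ext_d alpha p u v = 0.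
Proof.
move=> a0 eu ev; rewrite (@eq_ext_d _ _ (fun _ _ => 0) _ _ a0 eu ev) /ext_d.
have [/vfield_near_nbhs/nbhs_singleton[tA _] _] := extensionP eu.
have [/vfield_near_nbhs/nbhs_singleton[tB _] _] := extensionP ev.
by rewrite (tangent_cst _ tA) (tangent_cst _ tB) !subr0.
Qed.

End OnManifold.
End TangentVectors.

(** * Smooth actions and infinitesimal generators *)

Section SmoothActions.
Variable R : realType.

(** Smoothness of psi keeps the inner [push] from defaulting to 0 where the composite does not. *)
Lemma push_comp (X Y Z : smoothSpace R) (phi : X -> Y) (psi : Y -> Z)
    (p : X) (v : tvec X) : smooth_map_at psi (phi p) ->
  push psi (phi p) (push phi p v) = push (psi \o phi) p v.
Proof.
move=> spsi; apply/funext => f; rewrite /push /=.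
by case: asboolP => // sf; rewrite asboolT//; exact: spsi.
Qed.

Lemma push_id (X : smoothSpace R) (phi : X -> X) (p : X) (v : tvec X) :
  (forall x, phi x = x) -> tangent p v -> push phi p v = v.
Proof.
move=> /funext phiE [_ _ _ zv]; rewrite {}phiE; apply/funext => f.
by rewrite /push; case: asboolP => // /zv ->.
Qed.

Lemma pair_smooth_l (X Y : smoothSpace R) n (y : Y) (x : X) :
  is_manifold n X ->
  smooth_map_at (fun x' => (x', y) : prod_space X Y) x.
Proof.
move=> mX; apply: (smooth_map_at_smooth_gens mX) => _ [[a ga ->]|[b gb ->]].
  exact: gens_smooth_at.
exact: (smooth_at_cst mX x (b y)).
Qed.

Lemma pair_smooth_r (X Y : smoothSpace R) n (x : X) (y : Y) :
  is_manifold n Y ->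
  smooth_map_at (fun y' => (x, y') : prod_space X Y) y.
Proof.
move=> mY; apply: (smooth_map_at_smooth_gens mY) => _ [[a ga ->]|[b gb ->]].
  exact: (smooth_at_cst mY y (a x)).
exact: gens_smooth_at.
Qed.

Lemma distribution_tangent (X : smoothSpace R) (r : nat) (D : X -> set (tvec X)) q v :
  Defs.distribution r D -> D q v -> tangent q v.
Proof.
move=> /(_ q)[U [A [_ Uq vA /(_ q Uq)[bD _]]]] /bD[a ->].
by apply: tangent_sum => i; apply: tangentZ; exact: (vA i q Uq).1.
Qed.

Variables (Q : smoothSpace R) (G : lieGroup R) (act : G -> Q -> Q).
Variable n : nat.
Hypothesis mQ : is_manifold n Q.

Lemma rho_smooth q : smooth_map_at (rho act) q.
Proof. by apply: (smooth_map_at_smooth_gens mQ) => c; exact. Qed.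

Hypothesis hact : smooth_action act.

Lemma act_smooth g q : smooth_map_at (act g) q.
Proof.
move=> f sf; have [_ _ sa] := hact.
apply: (pair_smooth_r (X := lg_space G) (x := g) mQ (f := fun x => f (act x.1 x.2))).
exact: (sa (g, q)).
Qed.

Lemma orbit_map_smooth q g :
  smooth_map_at ((fun g' => act g' q) : lg_space G -> Q) g.
Proof.
move=> f sf; have [_ _ sa] := hact.
apply: (pair_smooth_l (Y := Q) (y := q) (@lg_manifold R G)
  (f := fun x => f (act x.1 x.2))).
exact: (sa (g, q)).
Qed.

Lemma generator_tangent eta q : lalg eta -> tangent q (generator act eta q).
Proof.
move=> teta; have [a1 _ _] := hact; rewrite -{1}(a1 q).
exact: (tangent_push mQ (@orbit_map_smooth q 1%g)).
Qed.

Lemma generator_linear a eta theta q :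
  generator act (a *: eta + theta) q
  = a *: generator act eta q + generator act theta q.
Proof. exact: push_linear. Qed.

Lemma generator_sum k (a : 'I_k -> R) eta q :
  generator act (\sum_i a i *: eta i) q = \sum_i a i *: generator act (eta i) q.
Proof. exact: push_sum. Qed.

Lemma generator0 q : generator act 0 q = 0.
Proof. exact: push0. Qed.

Lemma generator_rho eta q (f : orbit_space act -> R) :
  lalg eta -> generator act eta q (f \o rho act) = 0.
Proof.
(* Where f o rho is not smooth, [push] is 0 by convention; otherwise eta differentiates a constant
   function on G. *)
move=> teta; rewrite /generator /push; case: asboolP => // _.
have [a1 aM _] := hact.
suff -> : (f \o rho act) \o (fun g => act g q) = (fun=> f (rho act q)).
  exact: (tangent_cst (@lg_manifold R G) _ teta).
apply/funext => g /=; congr f; apply: eq_exist.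
apply/seteqP; split=> _ [h _ <-].
  by exists (h * g)%g => //; rewrite aM.
by exists (h * g^-1)%g => //; rewrite -aM mulgVK.
Qed.

End SmoothActions.

(** * The lifted action on M and the momentum map *)

Section MomentumMap.
Variables (R : realType) (N : nhSystem R) (G : lieGroup R).
Variable (act : G -> nh_Q N -> nh_Q N).
Local Notation Q := (nh_Q N).

Lemma tauM_smooth (m : M N) : smooth_map_at (@tauM R N) m.
Proof.
apply: smooth_map_at_gens => a ga; exists (fun m' => a (cot_pt m')) => //.
by left; exists a.
Qed.

Lemma cot_pt_smooth (m : cot Q) : smooth_map_at (@cot_pt R Q) m.
Proof. by apply: smooth_map_at_gens => a ga; left; exists a. Qed.

Lemma tangent_tauM (m : M N) u :
  tangent m u -> tangent (tauM m) (push (@tauM R N) m u).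
Proof. exact: (tangent_push (@nh_manifold R N) (@tauM_smooth m)). Qed.

Lemma momM_linear (m : M N) a u v :
  tangent (tauM m) u -> tangent (tauM m) v ->
  momM m (a *: u + v) = a * momM m u + momM m v.
Proof. by have [H _] := proj2_sig (iotaM m); exact: H. Qed.

Lemma Theta_M_momM (m : M N) v : Theta_M m v = momM m (push (@tauM R N) m v).
Proof.
rewrite /Theta_M /pull1 /Theta_Q push_comp//.
exact: cot_pt_smooth.
Qed.

Hypothesis hsym : g_symmetry act.

(* [act_M] is a choice: the set it chooses from contains [m o T(g^-1)], which is
   [Leg (Tg v0)] when [m = Leg v0], as the Lagrangian is invariant. *)
Lemma tauM_act_M g (m : M N) : tauM (act_M act g m) = act g (tauM m).
Proof.
have [hact _ _ hD hL] := hsym.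
have [a1 aM _] := hact.
have sa g' q' := act_smooth (@nh_manifold R N) hact (g := g') (q := q').
set q := tauM m; set gq := act g q.
have Kq : act g^-1%g gq = q by rewrite -aM mulVg a1.
pose back w := push (act g^-1%g) gq w : tvec Q.
have tback w : tangent gq w -> tangent q (back w).
  by move=> tw; rewrite -{1}Kq; exact: (tangent_push (@nh_manifold R N) (sa _ _) tw).
have backK w : tangent gq w -> push (act g) q (back w) = w.
  move=> tw; rewrite -{1}Kq /back push_comp; last exact: sa.
  by apply: push_id tw => x /=; rewrite -aM mulgV a1.
have [lm zm] := proj2_sig (iotaM m).
pose mom w := if `[< tangent gq w >] then momM m (back w) else 0.
have cmom : covector gq mom.
  split=> [c u v tu tv|u ntu]; last by rewrite /mom asboolF.
  have tuv := tangentZD c tu tv.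
  rewrite /mom !asboolT// /back push_linear.
  by apply: lm; exact: tback.
pose m1 : cot Q := exist (fun x : Q * _ => covector x.1 x.2) (gq, mom) cmom.
have Mm1 : Mset m1.
  have [v0 Dv0 mE] := proj2_sig m.
  have mE' : momM m = Leg q v0 by [].
  exists (push (act g) q v0); first exact: hD.
  rewrite /cot_mom /= /mom; apply/funext => w.
  case: asboolP => tw; last by rewrite /Leg asboolF.
  rewrite mE' /Leg !asboolT//; last exact: tback.
  congr (derive1 _ 0); apply/funext => t.
  have -> : push (act g) q v0 + t *: w = push (act g) q (t *: back w + v0).
    by rewrite push_linear backK// addrC.
  rewrite hL; first by rewrite addrC.
  apply: (tangentZD _ (tback _ tw)).
  exact: (distribution_tangent (@nh_distribution R N) Dv0).
have [] // := @xgetPex _ m [set m' | tauM m' = act g (tauM m) /\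
    forall w, tangent (act g (tauM m)) w ->
      momM m' w = momM m (push (act g^-1%g) (act g (tauM m)) w)].
exists (exist _ m1 Mm1); split=> // w tw.
by rewrite /momM /cot_mom /= /mom asboolT.
Qed.

(** Equivariance of tau makes T tau send eta_M to eta_Q. The two vectors are compared value by
    value, since [act_M] is a pointwise choice. *)
Lemma J_momM (m : M N) eta : J act m eta = momM m (generator act eta (tauM m)).
Proof.
rewrite /J Theta_M_momM; congr (momM m _); apply/funext => f.
have [[a1 _ _] _ _ _ _] := hsym.
rewrite /generator_M /generator /push /= !a1.
(* [act_M] at 1 and m is known only to lie over tau m, which is what smoothness of f o tau there
   requires. *)
case: asboolP => // sf; rewrite asboolT; last first.
  by apply: tauM_smooth; rewrite tauM_act_M a1.
by congr eta; apply/funext => g /=; rewrite tauM_act_M.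
Qed.

Lemma J_linear (m : M N) a eta theta : lalg eta -> lalg theta ->
  J act m (a *: eta + theta) = a * J act m eta + J act m theta.
Proof.
move=> le lt; have [hact _ _ _ _] := hsym.
rewrite !J_momM generator_linear momM_linear//.
  exact: (generator_tangent (@nh_manifold R N) hact).
exact: (generator_tangent (@nh_manifold R N) hact).
Qed.

Lemma J_sum (m : M N) k (a : 'I_k -> R) eta : (forall i, lalg (eta i)) ->
  J act m (\sum_i a i *: eta i) = \sum_i a i * J act m (eta i).
Proof.
elim: k a eta => [|k IH] a eta le.
  rewrite !big_ord0 J_momM generator0.
  have := momM_linear 1 (tangent0 (tauM m)) (tangent0 (tauM m)).
  rewrite scale1r addr0 mul1r.
  by move/(congr1 (fun z => z - momM m 0)); rewrite subrr addrK.
rewrite !big_ord_recl J_linear ?IH//.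
by apply: tangent_sum => i; apply: tangentZ; exact: le.
Qed.

End MomentumMap.

(** * Constant-rank distributions *)

Section Distributions.
Variables (R : realType) (X : smoothSpace R) (r : nat).
Variable D : X -> set (tvec X).
Hypothesis hD : Defs.distribution r D.

Lemma distribution_linear q a u v : D q u -> D q v -> D q (a *: u + v).
Proof.
have [U [A [_ Uq _ /(_ q Uq)[bD _]]]] := hD q.
move=> /bD[b ->] /bD[c ->]; apply/bD; exists (fun i => a * b i + c i).
rewrite scaler_sumr -big_split; apply: eq_bigr => i _.
by rewrite /= scalerDl scalerA.
Qed.

Lemma distribution0 q : D q 0.
Proof.
have [U [A [_ Uq _ /(_ q Uq)[bD _]]]] := hD q.
by apply/bD; exists (fun=> 0); rewrite big1// => i _; rewrite scale0r.
Qed.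

Lemma distributionB q u v : D q u -> D q v -> D q (u - v).
Proof.
by move=> Du Dv; rewrite addrC -scaleN1r; exact: distribution_linear.
Qed.

(** Freezing the coefficients of v in a local frame gives a field near q. *)
Lemma distribution_extensible n q v :
  is_manifold n X -> D q v -> extensible q v.
Proof.
move=> mX; have [U [A [oU Uq vA bA]]] := hD q.
move=> /(bA q Uq).1[b ->]; exists (fun p => \sum_i b i *: A i p); split=> //.
exists U; split=> // p Up; split.
  by apply: tangent_sum => i; apply: tangentZ; exact: (vA i p Up).1.
move=> f sf.
have -> : (fun q => (\sum_i b i *: A i q) f) = (fun q => \sum_i b i * A i q f).
  by apply/funext => z; rewrite fct_sumE.
apply: (smooth_at_sum mX) => i; apply: (smooth_atM mX).
  exact: (smooth_at_cst mX).
exact: (vA i p Up).2.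
Qed.

End Distributions.

(** * The splitting of TQ into H, S and W, and its dual forms *)

Section Frames.
Variables (R : realType) (N : nhSystem R) (G : lieGroup R).
Variable (act : G -> nh_Q N -> nh_Q N).
Local Notation Q := (nh_Q N).
Hypothesis hsym : g_symmetry act.
Variables (k : nat) (xi : 'I_k -> Q -> tvec (lg_space G)).
Hypothesis hxi : basis_gS act xi.
Variable X0 : Q -> tvec Q.
Hypothesis hH : forall q, Defs.basis_of (Hdist act q) (fun _ : 'I_1 => X0 q).
Variables (s : nat) (W : Q -> set (tvec Q)).
Hypothesis hW : vertical_complement act s W.
Variables (X0d : form1 Q) (Yd : 'I_k -> form1 Q).
Hypothesis hdual : dual_XY act xi X0 W X0d Yd.
Local Notation Y := (Yfield act xi).
Local Notation mQ := (@nh_manifold R N).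
Local Notation D := (@nh_D R N).

Let hact : smooth_action act. Proof. by case: hsym. Qed.

Lemma D_tangent q v : D q v -> tangent q v.
Proof. exact: (distribution_tangent (@nh_distribution R N)). Qed.

Lemma W_tangent q v : W q v -> tangent q v.
Proof. by case: hW => dW _ _ _; exact: (distribution_tangent dW). Qed.

Lemma D_extensible q v : D q v -> extensible q v.
Proof. exact: (distribution_extensible (@nh_distribution R N) mQ). Qed.

Lemma P_D_spec q v : tangent q v -> D q (P_D W q v) /\ W q (v - P_D W q v).
Proof.
case: hW => _ _ dec _ /dec[d [w [Dd Ww vE]]].
have : exists d, D q d /\ W q (v - d).
  by exists d; split=> //; rewrite vE addrAC subrr add0r.
by move/getPex.
Qed.

(** [P_D] is a choice; two candidates differ by a vector of both D and W, hence by 0. *)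
Lemma P_D_eq q d w : D q d -> W q w -> P_D W q (d + w) = d.
Proof.
move=> Dd Ww; case: hW => dW _ _ int.
have [|D1 W1] := @P_D_spec q (d + w).
  by apply: tangentD; [exact: D_tangent|exact: W_tangent].
apply/eqP; rewrite -subr_eq0; apply/eqP; apply: (int q).
  exact: (distributionB (@nh_distribution R N)).
have := distributionB dW Ww W1.
by rewrite opprB addrCA [d + w]addrC opprD (addrA w) subrr add0r.
Qed.

Lemma P_D_id q d : D q d -> P_D W q d = d.
Proof.
move=> Dd; rewrite -{1}[d]addr0 P_D_eq//.
by case: hW => dW _ _ _; exact: (distribution0 dW).
Qed.

Lemma P_W_D q d : D q d -> P_W W q d = 0.
Proof. by move=> Dd; rewrite /P_W P_D_id// subrr. Qed.

Lemma P_W_W q w : W q w -> P_W W q w = w.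
Proof.
move=> Ww; rewrite /P_W -[X in P_D W q X]add0r P_D_eq ?subr0//.
exact: (distribution0 (@nh_distribution R N)).
Qed.

Lemma Yfield_S i q : Sdist act q (Y i q).
Proof. by case: hxi => + _; move=> /(_ i)[_ /(_ q)[]]. Qed.

Lemma Yfield_tangent i q : tangent q (Y i q).
Proof. by apply: D_tangent; have [] := @Yfield_S i q. Qed.

Lemma X0_H q : Hdist act q (X0 q).
Proof.
apply/(hH q).1; exists (fun=> 1).
by rewrite big_ord_recl big_ord0 scale1r addr0.
Qed.

Lemma X0_D q : D q (X0 q).
Proof. by have [] := X0_H q. Qed.

Lemma Sdist_span q v : Sdist act q v -> exists a, v = \sum_i a i *: Y i q.
Proof.
move=> [Dv [eta le vE]]; have : gS act q eta.
  by split=> //; rewrite -vE; split=> //; exists eta.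
case: hxi => _ /(_ q)[bS _] /bS[a etaE]; exists a.
by rewrite vE etaE generator_sum.
Qed.

Lemma Yfield_free q (a : 'I_k -> R) :
  \sum_i a i *: Y i q = 0 -> forall i, a i = 0.
Proof.
move=> aY i; case: hdual => _ _ /(_ i)[fY _ YY _].
have := one_form_on_sum (I : [set: Q] q) fY a (fun j => Yfield_tangent j q).
rewrite aY (one_form_on0 (I : [set: Q] q) fY) (bigD1 i)//= YY eqxx mulr1.
by rewrite big1 ?addr0 // => j ji; rewrite YY eq_sym (negbTE ji) mulr0.
Qed.

Lemma kappa_suml q m (a : 'I_m -> R) (u : 'I_m -> tvec Q) w :
  (forall i, tangent q (u i)) -> tangent q w ->
  nh_kappa q (\sum_i a i *: u i) w = \sum_i a i * nh_kappa q (u i) w.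
Proof.
have [lin _ _ _] := @nh_riemannian R N q; move=> tu tw.
have k0 : nh_kappa q 0 w = 0.
  have := lin 1 _ _ _ (tangent0 q) (tangent0 q) tw; rewrite scale1r addr0 mul1r.
  by move/(congr1 (fun z => z - nh_kappa q 0 w)); rewrite subrr addrK.
elim: m a u tu => [|m IH] a u tu; first by rewrite !big_ord0.
rewrite !big_ord_recl lin ?IH//.
by apply: tangent_sum => i; exact: tangentZ.
Qed.

(** A row a killed by the Gram matrix gives v, the combination of the Y_i, orthogonal to every Y_l
    and so to itself; positivity and independence force a = 0. *)
Lemma kappa_mx_unit q : kappa_mx act xi q \in unitmx.
Proof.
have [lin sym pos _] := @nh_riemannian R N q.
rewrite -row_free_unit; apply: inj_row_free => a aK.
pose v := \sum_i a 0 i *: Y i q.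
have tv : tangent q v by apply: tangent_sum => i; apply: tangentZ; exact: Yfield_tangent.
have vY l : nh_kappa q v (Y l q) = 0.
  rewrite kappa_suml; try by move=> *; exact: Yfield_tangent.
  transitivity ((a *m kappa_mx act xi q) 0 l); last by rewrite aK mxE.
  by rewrite mxE; apply: eq_bigr => i _; rewrite mxE.
have vv : nh_kappa q v v = 0.
  rewrite {1}/v kappa_suml// => [|i]; last exact: Yfield_tangent.
  apply: big1 => i _; rewrite sym//; last exact: Yfield_tangent.
  by rewrite vY mulr0.
have v0 : v = 0 by apply: contrapT => /(pos v tv); rewrite vv ltxx.
by apply/rowP => i; rewrite mxE; exact: (Yfield_free v0).
Qed.

(** Inverting the Gram matrix gives v, the orthogonal projection of d onto S; then d - v lies in D
    and is orthogonal to S, so it is a multiple of X_0. *)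
Lemma D_decomposition q d : D q d ->
  exists c a, d = c *: X0 q + \sum_i a i *: Y i q.
Proof.
move=> Dd; have [lin sym _ _] := @nh_riemannian R N q.
pose b : 'rV[R]_k := \row_l nh_kappa q d (Y l q).
pose a := b *m invmx (kappa_mx act xi q).
have aK : a *m kappa_mx act xi q = b by rewrite mulmxKV// kappa_mx_unit.
pose v := \sum_i a 0 i *: Y i q.
have tv : tangent q v by apply: tangent_sum => i; apply: tangentZ; exact: Yfield_tangent.
have Dv : D q v.
  rewrite /v; elim/big_ind: _ => [||i _].
  - exact: (distribution0 (@nh_distribution R N)).
  - move=> u1 u2 D1 D2; rewrite -[u1]scale1r.
    exact: (distribution_linear (@nh_distribution R N)).
  - rewrite -[_ *: _]addr0; apply: (distribution_linear (@nh_distribution R N)).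
      by have [] := @Yfield_S i q.
    exact: (distribution0 (@nh_distribution R N)).
have tdv : tangent q (d - v) by apply: tangentB => //; exact: D_tangent.
have : Hdist act q (d - v).
  split; first exact: (distributionB (@nh_distribution R N)).
  move=> _ /Sdist_span[e ->]; rewrite sym//; last first.
    by apply: tangent_sum => i; apply: tangentZ; exact: Yfield_tangent.
  rewrite kappa_suml// => [|i]; last exact: Yfield_tangent.
  apply: big1 => l _; rewrite sym//; last exact: Yfield_tangent.
  have -> : d - v = (-1) *: v + d by rewrite scaleN1r addrC.
  rewrite lin//; [|exact: D_tangent|exact: Yfield_tangent].
  rewrite kappa_suml; try by move=> *; exact: Yfield_tangent.
  have -> : nh_kappa q d (Y l q) = (a *m kappa_mx act xi q) 0 l.
    by rewrite aK mxE.
  rewrite [(a *m _) 0 l]mxE mulN1r addrC; apply/eqP; rewrite mulf_eq0 subr_eq0.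
  apply/orP; right; apply/eqP; apply: eq_bigr => i _.
  by rewrite [kappa_mx _ _ _ _ _]mxE.
move=> /(hH q).1[c]; rewrite big_ord_recl big_ord0 addr0 => dE.
by exists (c ord0), (a 0); rewrite -dE subrK.
Qed.

Lemma frame_decomposition q v : tangent q v ->
  exists c a w, W q w /\ v = c *: X0 q + \sum_i a i *: Y i q + w.
Proof.
move=> /P_D_spec[/D_decomposition[c [a dE]] Ww].
by exists c, a, (v - P_D W q v); split=> //; rewrite -dE addrC subrK.
Qed.

Lemma one_form_frame (U : set Q) (alpha : form1 Q) q c (a : 'I_k -> R) w :
  one_form_on U alpha -> U q -> W q w ->
  alpha q (c *: X0 q + \sum_i a i *: Y i q + w)
  = c * alpha q (X0 q) + \sum_i a i * alpha q (Y i q) + alpha q w.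
Proof.
move=> fa Uq Ww.
have tX : tangent q (X0 q) by apply: D_tangent; exact: X0_D.
have tY i := Yfield_tangent i q; have tw := W_tangent Ww.
have tYs : tangent q (\sum_i a i *: Y i q).
  by apply: tangent_sum => i; exact: tangentZ.
rewrite (one_form_onD Uq fa)//; last exact: tangentZD.
by rewrite (one_form_onP Uq fa)// (one_form_on_sum Uq fa).
Qed.

Lemma W0 q : W q 0.
Proof. by case: hW => dW _ _ _; exact: (distribution0 dW). Qed.

Lemma X0d_D q c a : X0d q (c *: X0 q + \sum_i a i *: Y i q) = c.
Proof.
case: hdual => fX [XX XY XW] _.
rewrite -[_ + _]addr0 (one_form_frame _ _ fX I (W0 q)) XX (XW _ _ (W0 q)) addr0 mulr1.
by rewrite big1 ?addr0// => i _; rewrite XY mulr0.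
Qed.

Lemma one_form_P_D (alpha : form1 Q) q v :
  one_form alpha -> (forall w, W q w -> alpha q w = 0) -> tangent q v ->
  alpha q (P_D W q v) = alpha q v.
Proof.
move=> fa aW tv; have [DP WP] := P_D_spec tv.
rewrite -[v in RHS](subrK (P_D W q v)) (one_form_onD I fa).
- by rewrite (aW _ WP) add0r.
- exact: W_tangent.
- exact: D_tangent.
Qed.

(** * Horizontal gauge symmetries and the differentials of the Y^i *)

Section GaugeSymmetries.
Variable X0bar : orbit_space act -> tvec (orbit_space act).
Hypothesis hX0bar : forall q, push (rho act) q (X0 q) = X0bar (rho act q).
Variables (fbar : 'I_k -> 'I_k -> orbit_space act -> R).
Variables (zeta : 'I_k -> Q -> tvec (lg_space G)).
Hypothesis hzeta : hgs_basis xi X0 X0bar fbar zeta.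
Variable Yhgs : 'I_k -> form1 Q.
Hypothesis hYhgs : is_Y_HGS act W zeta Yhgs.

Let f l i : Q -> R := fbar l i \o rho act.

Lemma gen_section_zeta l q :
  gen_section act (zeta l) q = \sum_i f l i q *: Y i q.
Proof.
by case: hzeta => _ _ _ zE _; rewrite /gen_section zE generator_sum.
Qed.

(* [Yhgs l (Y j)] is the inverse of the transpose of the matrix [f]. *)
Lemma Yhgs_Yfield i j q :
  \sum_l f l i q * Yhgs l q (Y j q) = (i == j)%:R.
Proof.
pose E : 'M[R]_k := \matrix_(l, j) Yhgs l q (Y j q).
pose F : 'M[R]_k := \matrix_(l, j) f l j q.
have EF : E *m F^T = 1%:M.
  apply/matrixP => l m; rewrite !mxE; have [fY Yz _ _] := hYhgs l.
  rewrite -(Yz m q) gen_section_zeta (one_form_on_sum (I : [set: Q] q) fY).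
    by apply: eq_bigr => i' _; rewrite !mxE mulrC.
  by move=> i'; exact: Yfield_tangent.
transitivity ((F^T *m E) i j); last by rewrite (mulmx1C EF) mxE.
by rewrite mxE; apply: eq_bigr => l _; rewrite !mxE.
Qed.

(** Both sides vanish on X_0 and on W; on the Y_j they agree by [Yhgs_Yfield]. *)
Lemma Yd_Yhgs i q v : tangent q v ->
  Yd i q v = \sum_l f l i q * Yhgs l q v.
Proof.
case: hdual => _ _ /(_ i)[fY YX YY YW].
move=> /frame_decomposition[c [a [w [Ww ->]]]].
rewrite (one_form_frame _ _ fY I Ww) YX (YW _ _ Ww) mulr0 add0r addr0.
have E l : Yhgs l q (c *: X0 q + \sum_i a i *: Y i q + w)
    = \sum_j a j * Yhgs l q (Y j q).
  have [fh _ hH0 hW0] := hYhgs l.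
  rewrite (one_form_frame _ _ fh I Ww) (hW0 _ _ Ww) (hH0 _ _ (X0_H q)).
  by rewrite mulr0 add0r addr0.
under [RHS]eq_bigr do rewrite E mulr_sumr.
rewrite exchange_big; apply: eq_bigr => j _ /=.
rewrite YY -(Yhgs_Yfield i j q) mulr_sumr.
by apply: eq_bigr => l _; ring.
Qed.


Lemma fbar_rho_smooth l i q : smooth_at (f l i) q.
Proof.
case: hzeta => sf _ _ _ _; apply: (rho_smooth mQ); exact: sf.
Qed.

Lemma fbar_rho_derivative l i q d : D q d ->
  d (f l i) = X0d q d * \sum_j Rcoef act xi X0 i j q * f l j q.
Proof.
move=> Dd; have [c [a ->]] := D_decomposition Dd; rewrite X0d_D.
case: hzeta => sf ode _ _ _.
have Xf : X0 q (f l i) = \sum_j Rcoef act xi X0 i j q * f l j q.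
  transitivity (X0bar (rho act q) (fbar l i)).
    by rewrite -hX0bar /push asboolT//; exact: sf.
  by apply/esym/eqP; rewrite -subr_eq0 ode.
transitivity (c * X0 q (f l i) + (\sum_i a i *: Y i q) (f l i)) => //.
rewrite Xf fct_sumE [X in _ + X]big1 ?addr0// => j _.
have [_ /(_ q)[lx _]] := hxi.1 j.
have Y0 : Y j q (f l i) = 0 by exact: (generator_rho hact q (fbar l i) lx).
by rewrite -[LHS]/(a j * Y j q (f l i)) Y0 mulr0.
Qed.

Lemma ext_d_Yd i q a b : D q a -> D q b ->
  ext_d (Yd i) q a b = \sum_l f l i q * ext_d (Yhgs l) q a b
   + \sum_j Rcoef act xi X0 i j q * wedge X0d (Yd j) q a b.
Proof.
move=> Da Db; have hq : [set: Q] q by [].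
rewrite (ext_d_sum mQ hq (fun l => let: And4 h _ _ _ := hYhgs l in h)
  (fun l => fbar_rho_smooth l i q)); last 3 first.
- by apply: filterE => p v; exact: Yd_Yhgs.
- exact: D_extensible.
- exact: D_extensible.
rewrite big_split addrC; congr (_ + _) => /=.
(* The ODE turns c(f^l_i) into X^0(c) R_ij f^l_j, and summing f^l_j Y^l_HGS(e) over l restores
   Y^j(e). Antisymmetrizing in the two vectors yields the wedge. *)
have E c e : D q c -> D q e -> \sum_l c (f l i) * Yhgs l q e =
    \sum_j Rcoef act xi X0 i j q * (X0d q c * Yd j q e).
  move=> Dc De.
  under eq_bigr do rewrite (fbar_rho_derivative _ _ Dc) -mulrA mulr_suml mulr_sumr.
  rewrite exchange_big; apply: eq_bigr => j _ /=.
  rewrite Yd_Yhgs; last exact: D_tangent.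
  by rewrite !mulr_sumr; apply: eq_bigr => l _; ring.
rewrite sumrB !E// -sumrB; apply: eq_bigr => j _.
by rewrite /wedge; ring.
Qed.

Lemma ext_d_Yd_xi q a b : D q a -> D q b ->
  \sum_i ext_d (Yd i) q a b *: xi i q =
  \sum_l ext_d (Yhgs l) q a b *: zeta l q
  + \sum_i \sum_j (Rcoef act xi X0 i j q * wedge X0d (Yd j) q a b) *: xi i q.
Proof.
move=> Da Db; case: hzeta => _ _ _ zE _.
under eq_bigr do rewrite ext_d_Yd// scalerDl.
rewrite big_split /=; congr (_ + _); last first.
  by apply: eq_bigr => i _; rewrite scaler_suml.
under [RHS]eq_bigr do rewrite zE scaler_sumr.
rewrite exchange_big; apply: eq_bigr => i _ /=.
rewrite scaler_suml; apply: eq_bigr => l _.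
by rewrite scalerA mulrC.
Qed.

End GaugeSymmetries.

(** * The curvature K_W and its expression in a frame of W *)

Section Curvature.
Variable A_W : gform1 Q G.
Hypothesis hA_W : is_A_W act W A_W.

Lemma A_W_D q d : D q d -> A_W q d = 0.
Proof.
move=> Dd; case: hA_W => _ /(_ q d (D_tangent Dd) 0 (tangent0 _)) H.
by apply/H; rewrite generator0 P_W_D.
Qed.

Lemma generator_A_W q v : tangent q v -> generator act (A_W q v) q = P_W W q v.
Proof. by move=> tv; case: hA_W => -[tA _] /(_ q v tv _ (tA q v tv))[H _]; exact: H. Qed.

(** Required because J is linear only on the Lie algebra. Each axiom of [tangent] is a linear
    relation between component forms of A_W with coefficients constant on Q (for Leibniz, the values
    of g and h at 1), and [ext_d] preserves such relations. *)
Lemma gext_d_tangent q a b : D q a -> D q b -> lalg (gext_d A_W q a b).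
Proof.
move=> Da Db; have hq : [set: Q] q by [].
case: hA_W => -[tA fA] _.
have ea := D_extensible Da; have eb := D_extensible Db.
split=> [c g h sg sh|g h sg sh|g h gh|g nsg]; rewrite /gext_d.
- rewrite (@ext_d_lin2 _ _ _ mQ q setT c 1 _ (fun q v => A_W q v g)
    (fun q v => A_W q v h))//; try exact: fA.
    by rewrite mul1r.
  by apply: filterE => p w tw; rewrite mul1r; case: (tA p w tw) => + _ _ _; exact.
- rewrite (@ext_d_lin2 _ _ _ mQ q setT (g 1%g) (h 1%g) _ (fun q v => A_W q v h)
    (fun q v => A_W q v g))//; try exact: fA.
  by apply: filterE => p w tw; case: (tA p w tw) => _ + _ _; exact.
- apply: (eq_ext_d mQ) => //; apply: filterE => p w tw.
  by case: (tA p w tw) => _ _ + _; exact.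
- apply: (ext_d_eq0 mQ) => //; apply: filterE => p w tw.
  by case: (tA p w tw) => _ _ _; exact.
Qed.

Lemma gext_d_frame (U : set Q) (Z : 'I_s -> Q -> tvec Q) (eps : 'I_s -> form1 Q)
    q a b :
  local_frame_W act xi X0 W U Z eps -> U q -> D q a -> D q b ->
  gext_d A_W q a b = \sum_c ext_d (eps c) q a b *: A_W q (Z c q).
Proof.
move=> [oU vZ bZ hZ] Uq Da Db.
case: hA_W => -[tA fA] _.
have ea := D_extensible Da; have eb := D_extensible Db.
have epsD p c d : U p -> D p d -> eps c p d = 0.
  move=> Up /D_decomposition[e [x ->]]; have [fe eX eY _] := hZ c.
  rewrite -[_ + _]addr0 (one_form_frame _ _ fe Up (W0 p)) eX//.
  rewrite (one_form_on0 Up fe) mulr0 add0r addr0.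
  by rewrite big1// => i _; rewrite eY// mulr0.
have AE p w g : smooth_at g (1%g : lg_space G) -> U p -> tangent p w ->
    A_W p w g = \sum_c A_W p (Z c p) g * eps c p w.
  move=> sg Up tw; have [DP WP] := P_D_spec tw.
  have tZ c : tangent p (Z c p) by exact: (vZ c p Up).1.
  have tP := D_tangent DP; have tW := W_tangent WP.
  have fAg : one_form_on setT (fun p v => A_W p v g) by exact: fA.
  rewrite -{1}[w](subrK (P_D W p w)) (one_form_onD I fAg)//.
  rewrite (A_W_D DP) -[(0 : tvec _) g]/0 addr0.
  have [x wE] := ((bZ p Up).1 _).1 WP.
  rewrite wE (one_form_on_sum I fAg)//; apply: eq_bigr => c _; rewrite mulrC.
  congr (_ * _); have [fe _ _ eZ] := hZ c.
  rewrite -[w](subrK (P_D W p w)) (one_form_onD Up fe)// (epsD _ _ _ Up DP) addr0.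
  rewrite wE (one_form_on_sum Up fe)// (bigD1 c)//= eZ// eqxx mulr1.
  by rewrite big1 ?addr0// => c' c'c; rewrite eZ// eq_sym (negbTE c'c) mulr0.
apply/funext => g; rewrite fct_sumE /gext_d.
(* Lie algebra elements vanish on functions not smooth at 1, so for such g both sides are 0. *)
have [sg|nsg] := pselect (smooth_at g (1%g : lg_space G)).
  rewrite (ext_d_sum (F := fun c q => A_W q (Z c q) g) mQ Uq
    (fun c => let: And4 h _ _ _ := hZ c in h)) //.
  - apply: eq_bigr => c _; rewrite !epsD// !mulr0 subrr add0r.
    by rewrite fctE mulrC.
  - move=> c; have [_ H] := fA g sg q I; apply: H.
    by exists U.
  - by apply: filterS (open_nbhs_nbhs (conj oU Uq)) => p Up w; exact: AE.
have A0 p w : tangent p w -> A_W p w g = 0.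
  by move=> tw; case: (tA p w tw) => _ _ _; exact.
rewrite big1 => [|c _]; last first.
  by rewrite fctE A0 ?scaler0//; exact: (vZ c q Uq).1.
by rewrite (ext_d_eq0 mQ)//; apply: filterE => p w; exact: A0.
Qed.

End Curvature.

End Frames.

(** * The two formulas for B_HGS *)

Unset Implicit Arguments.
Set Strict Implicit.

Theorem theorem4p10 (R : realType) (N : nhSystem R) (G : lieGroup R)
  (act : G -> nh_Q N -> nh_Q N)
  (hsym : g_symmetry act)
  (hA1 : condA1 act) (hA2 : condA2 act) (hA3 : condA3 act) (hA4 : condA4 act)
  (k : nat) (xi : 'I_k -> nh_Q N -> tvec (lg_space G))
  (hxi : basis_gS act xi)
  (hxi_inv : forall i, ginvariant_section act (xi i))
  (X0 : nh_Q N -> tvec (nh_Q N))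
  (X0bar : orbit_space act -> tvec (orbit_space act))
  (hX0 : horizontal_generator X0 X0bar)
  (hstrong : strong_invariant act)
  (hkX0 : forall Y : nh_Q N -> tvec (nh_Q N), section_S act Y ->
     forall q, nh_kappa q (X0 q) (lie_bracket Y X0 q) = 0)
  (s : nat) (W : nh_Q N -> set (tvec (nh_Q N)))
  (hW : vertical_complement act s W)
  (A_W : gform1 (nh_Q N) G) (hA_W : is_A_W act W A_W)
  (fbar : 'I_k -> 'I_k -> orbit_space act -> R)
  (zeta : 'I_k -> nh_Q N -> tvec (lg_space G))
  (hzeta : hgs_basis xi X0 X0bar fbar zeta)
  (Yhgs : 'I_k -> form1 (nh_Q N)) (hYhgs : is_Y_HGS act W zeta Yhgs)
  (X0d : form1 (nh_Q N)) (Yd : 'I_k -> form1 (nh_Q N))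
  (hdual : dual_XY act xi X0 W X0d Yd) :
  let tau := @tauM R N in
  let XwY j := wedge (pull1 tau X0d) (pull1 tau (Yd j)) in
  let RXY i j : form2 (M N) :=
    fun m u v => Rcoef act xi X0 i j (tau m) * XwY j m u v in
  (forall (m : M N) (u v : tvec (M N)), tangent m u -> tangent m v ->
     B_HGS act W A_W zeta Yhgs m u v =
       J_pair act (calK_W W A_W) m u v
       - J_pair act
           (fun m u v => \sum_i \sum_j tensor (RXY i j) (xi i) m u v) m u v
       + J_pair act
           (fun m u v => \sum_i tensor (dC W (Yd i)) (xi i) m u v) m u v)
  /\
  (forall (U : set (nh_Q N)) (Z : 'I_s -> nh_Q N -> tvec (nh_Q N))
     (eps : 'I_s -> form1 (nh_Q N)),
     local_frame_W act xi X0 W U Z eps ->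
     forall (m : M N) (u v : tvec (M N)),
       U (tau m) -> tangent m u -> tangent m v ->
     B_HGS act W A_W zeta Yhgs m u v =
       \sum_a momM m (Z a (tau m)) * dC W (eps a) m u v
       - \sum_i \sum_j J_of act (xi i) m * Rcoef act xi X0 i j (tau m)
           * XwY j m u v
       + \sum_i J_of act (xi i) m * dC W (Yd i) m u v).
Proof.
move=> tau XwY RXY.
have [hX hH hXb hproj] := hX0.
have fX : one_form X0d by case: hdual.
have fY i : one_form (Yd i) by case: hdual => _ _ /(_ i)[].
have X0dW q w : W q w -> X0d q w = 0 by case: hdual => _ [_ _ +] _; exact.
have YdW i q w : W q w -> Yd i q w = 0 by case: hdual => _ _ /(_ i)[_ _ _]; exact.
have lxi i q : lalg (xi i q) by have [_ /(_ q)[]] := hxi.1 i.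
have lzeta i q : lalg (zeta i q).
  by case: hzeta => _ _ _ _ [[hz _] _ _]; have [_ /(_ q)[]] := hz i.
have tP (m : M N) u : tangent m u -> nh_D (tau m) (P_D W (tau m) (push tau m u)).
  by move=> tu; have [] := P_D_spec hW (tangent_tauM tu).
have XwYE j (m : M N) u v : tangent m u -> tangent m v -> XwY j m u v =
    wedge X0d (Yd j) (tau m) (P_D W (tau m) (push tau m u))
      (P_D W (tau m) (push tau m v)).
  move=> /tangent_tauM tu /tangent_tauM tv.
  have PX w : tangent (tau m) w -> X0d (tau m) (P_D W (tau m) w) = X0d (tau m) w.
    by move=> tw; exact: (one_form_P_D hW fX (X0dW _) tw).
  have PY w : tangent (tau m) w -> Yd j (tau m) (P_D W (tau m) w) = Yd j (tau m) w.
    by move=> tw; exact: (one_form_P_D hW (fY j) (YdW j _) tw).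
  by rewrite /wedge !PX// !PY.
have JR (m : M N) u v : J_pair act
    (fun m u v => \sum_i \sum_j tensor (RXY i j) (xi i) m u v) m u v =
    \sum_i \sum_j J_of act (xi i) m * Rcoef act xi X0 i j (tau m) * XwY j m u v.
  rewrite /J_pair.
  under [X in J _ _ X]eq_bigr do rewrite /tensor -scaler_suml.
  rewrite (J_sum hsym)//; apply: eq_bigr => i _; rewrite mulr_suml.
  by apply: eq_bigr => j _; rewrite mulrC mulrA.
have first : forall (m : M N) (u v : tvec (M N)), tangent m u -> tangent m v ->
     B_HGS act W A_W zeta Yhgs m u v =
       J_pair act (calK_W W A_W) m u v
       - J_pair act
           (fun m u v => \sum_i \sum_j tensor (RXY i j) (xi i) m u v) m u v
       + J_pair act
           (fun m u v => \sum_i tensor (dC W (Yd i)) (xi i) m u v) m u v.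
  move=> m u v tu tv; have Du := tP m u tu; have Dv := tP m v tv.
  have lK : lalg (calK_W W A_W m u v) by exact: (gext_d_tangent hA_W Du Dv).
  (* The Y^i term on the right becomes [SH + SR]: [SH] is the term of [sigma_HGS], and [SR] cancels
     the subtracted sum once J is distributed. *)
  have SYE := ext_d_Yd_xi hsym hxi hH hW hdual hproj hzeta hYhgs Du Dv.
  rewrite /B_HGS /J_pair /sigma_HGS /tensor [X in _ + J _ _ X]SYE.
  under [X in _ - J _ _ X]eq_bigr do under eq_bigr do rewrite /RXY XwYE//.
  set SH := \sum_l _ *: zeta l _; set SR := \sum_i \sum_j _ *: xi i _.
  have lSH : lalg SH by apply: tangent_sum => i; apply: tangentZ; exact: lzeta.
  have lSR : lalg SR.
    by apply: tangent_sum => i; apply: tangent_sum => j; apply: tangentZ; exact: lxi.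
  rewrite -[calK_W _ _ _ _ _ + _]/(calK_W W A_W m u v + SH).
  rewrite -[calK_W _ _ _ _ _ in LHS]scale1r -[SH in RHS]scale1r !(J_linear hsym)//.
  by rewrite !mul1r; ring.
split=> // U Z eps hZ m u v Um tu tv.
have Du := tP m u tu; have Dv := tP m v tv.
rewrite first// JR; congr (_ - _ + _).
  rewrite /J_pair /calK_W (gext_d_frame hxi hH hW hdual hA_W hZ Um Du Dv).
  have [_ vZ bZ _] := hZ.
  have tZ c : tangent (tau m) (Z c (tau m)) by exact: (vZ c _ Um).1.
  rewrite (J_sum hsym) => [|c]; last by case: hA_W => -[tA _] _; exact: tA.
  apply: eq_bigr => c _; rewrite mulrC (J_momM hsym) (generator_A_W hA_W)//.
  rewrite (P_W_W hW)//; apply/(bZ _ Um).1.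
  exists (fun b => (b == c)%:R); rewrite (bigD1 c)//= eqxx scale1r big1 ?addr0//.
  by move=> b /negbTE ->; rewrite scale0r.
rewrite /J_pair /tensor (J_sum hsym)//.
by apply: eq_bigr => i _; rewrite mulrC.
Qed.
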